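(* Let $n,N,k\in\mathbb N$, let $\Omega\subset\mathbb R^n$ be a bounded open set, and let $\mathrm H:\Omega\times\mathbb R^\Lambda\to[0,\infty)$ be a Carathéodory function with $\mathrm H(x,0)=0$ for a.e. $x\in\Omega$, satisfying the following two conditions. (1) (Uniform strict radial monotonicity) There is a continuous function $c:[0,1]\times[0,\infty)\to[0,\infty)$ with $c(1,\cdot)=c(\cdot,0)=0$ and $c>0$ on $(0,1)\times(0,\infty)$ such that $$\mathrm H(x,tX)\le \mathrm H(x,X)-c(t,|X|)\qquad \forall\, t\in[0,1],\ \forall\, X\in\mathbb R^\Lambda,\ \text{a.e. } x\in\Omega .$$ (2) (Uniform modulus of continuity) For every $R>0$ there is a non-decreasing $\omega_R\in C(0,\infty)$ with $\omega_R(0^+)=0$ such that $$|\mathrm H(x,X)-\mathrm H(x,X')|\le \omega_R(|X-X'|)\qquad \text{a.e. } x\in\Omega,\ \forall\, X,X'\in\overline{\mathbb B}_R(0),\ X\neq X'.$$ Assume that $u\in W^{k,\infty}(\Omega,\mathbb R^N)$ is an absolute minimiser of $\mathrm E_\infty$ on $\Omega$, i.e. $$\mathrm E_\infty(u,U)\le \mathrm E_\infty(u+\phi,U)\qquad\forall\,\phi\in W^{k,\infty}_0(U,\mathbb R^N),\ \forall\, U\subseteq\Omega\text{ open}.$$ Then $u$ satisfies the energy maximum principle in $\Omega$: $$\operatorname*{ess\,sup}_{U}\mathrm H\big(\cdot,\mathrm D^{\vec k}u\big)=\sup_{\partial U}\mathrm H\big(\cdot,\mathrm D^{\vec k}u\big)^*\qquad\forall\,U\subseteq\Omega\text{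 open}.$$
   Context: Notation: $\mathbb R^\Lambda\cong\mathbb R^N\times\mathbb R^{Nn}\times\dots\times\mathbb R^{Nn^k}$, so $\Lambda=N(1+n+\dots+n^k)$; $\overline{\mathbb B}_R(0)$ is the closed ball of radius $R$ centred at $0$ in $\mathbb R^\Lambda$ and $|\cdot|$ is the Euclidean norm. $\mathrm H$ Carathéodory means: $x\mapsto \mathrm H(x,X)$ is Lebesgue measurable for every $X$, and $X\mapsto\mathrm H(x,X)$ is continuous for a.e. $x$. For $u\in W^{k,\infty}(\Omega,\mathbb R^N)$, the jet of order $k$ is $\mathrm D^{\vec k}u:=(u,\mathrm Du,\dots,\mathrm D^ku):\Omega\to\mathbb R^\Lambda$. The supremal functional is $$\mathrm E_\infty(u,U):=\operatorname*{ess\,sup}_{x\in U}\mathrm H\big(x,\mathrm D^{\vec k}u(x)\big),\qquad U\subseteq\Omega\text{ Lebesgue measurable}.$$ $W^{k,\infty}_0(U,\mathbb R^N)$ is the space of $W^{k,\infty}(U,\mathbb R^N)$ maps with zero boundary values, $W^{k,\infty}(U,\mathbb R^N)\cap W^{k,1}_0(U,\mathbb R^N)$. Essential limsup: for an open set $U\subseteq\Omega$ and $h\in L^\infty(U)$, $$h^*(x):=\lim_{\varepsilon\to0}\Big(\operatorname*{ess\,sup}_{B_\varepsilon(x)\cap U}h\Big),\qquad x\in\overline U .$$ In the conclusion, for each open $U$, $\mathrm H(\cdot,\mathrm D^{\vec k}u)^*$ is the essential limsup of the restriction of $\mathrm H(\cdot,\mathrm D^{\vec k}u)$ to $U$. 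*)

(* Defs.v *)
From HB Require Import structures.
From mathcomp Require Import all_boot all_order all_algebra.
From mathcomp Require Import all_classical all_reals all_analysis ess_sup_inf.

Set Implicit Arguments.
Unset Strict Implicit.
Unset Printing Implicit Defensive.

Import Order.TTheory GRing.Theory Num.Theory.
Import numFieldNormedType.Exports.

Local Open Scope classical_set_scope.
Local Open Scope ring_scope.

(** * Lebesgue measure on R^n

    Caratheodory's construction from the outer measure given by countable
    covers by half-open boxes ]a, b].  [None] stands for the empty box, which is
    needed for [set0] to have measure 0 when n = 0. *)

Section LebesgueOuterMeasure.
Context {R : realType} {n : nat}.
Implicit Types (p : option ('rV[R]_n * 'rV[R]_n)) (A : set 'rV[R]_n).

Definition box p : set 'rV[R]_n :=
  if p is Some (a, b) then [set x | forall i, a 0 i < x 0 i <= b 0 i] else set0.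

Definition box_volume p : \bar R :=
  if p is Some (a, b) then (\prod_i Num.max 0 (b 0 i - a 0 i))%:E else 0%E.

Definition box_cover A : set (option ('rV[R]_n * 'rV[R]_n))^nat :=
  [set F | A `<=` \bigcup_k box (F k)].

Definition lebesgue_outer A : \bar R :=
  ereal_inf [set \sum_(k <oo) box_volume (F k) | F in box_cover A]%E.

Local Open Scope ereal_scope.

Lemma box_volume_ge0 p : 0 <= box_volume p.
Proof.
case: p => [[a b]|//]; rewrite lee_fin; apply: prodr_ge0 => i _.
by rewrite le_max lexx.
Qed.

Lemma lebesgue_outer_ge0 A : 0 <= lebesgue_outer A.
Proof.
apply: le_ereal_inf_tmp => _ [F _ <-].
by apply: nneseries_ge0 => k _ _; exact: box_volume_ge0.
Qed.

Lemma lebesgue_outer0 : lebesgue_outer set0 = 0.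
Proof.
apply/eqP; rewrite eq_le lebesgue_outer_ge0 andbT; apply: ereal_inf_lbound.
by exists (fun=> None); [exact: sub0set|rewrite eseries0].
Qed.

Lemma le_lebesgue_outer : {homo lebesgue_outer : A B / A `<=` B >-> A <= B}.
Proof.
move=> A B AB; apply: ereal_inf_le_tmp => _ [F BF <-].
by exists F => //; exact: subset_trans BF.
Qed.

Lemma lebesgue_outer_sigma_subadditive : sigma_subadditive lebesgue_outer.
Proof.
move=> A; have [[i ioo]|/forallNP Aoo] :=
    pselect (exists i, lebesgue_outer (A i) = +oo).
  rewrite (eseries_pinfty _ _ ioo) ?leey// => k _.
  by rewrite -ltNye (lt_le_trans _ (lebesgue_outer_ge0 _)).
apply/lee_addgt0Pr => _/posnumP[e].
rewrite (le_trans _ (epsilon_trick _ _ _))//; last first.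
  by move=> k; exact: lebesgue_outer_ge0.
have [G PG] : {G : nat -> (option ('rV[R]_n * 'rV[R]_n))^nat & forall k,
    box_cover (A k) (G k) /\ \sum_(j <oo) box_volume (G k j) <=
      lebesgue_outer (A k) + (e%:num / (2 ^ k.+1)%:R)%:E}.
  apply: (@choice _ _ (fun k F => box_cover (A k) F /\
    \sum_(j <oo) box_volume (F j) <=
      lebesgue_outer (A k) + (e%:num / (2 ^ k.+1)%:R)%:E)) => k.
  have fA : lebesgue_outer (A k) \is a fin_num.
    rewrite ge0_fin_numE ?lebesgue_outer_ge0// lt_neqAle leey andbT.
    exact/eqP/Aoo.
  have ek : (0 < e%:num / (2 ^ k.+1)%:R)%R by [].
  have [_ [F AF <-] ltF] := lb_ereal_inf_adherent ek fA.
  by exists F; split => //; exact: ltW.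
pose v (q : nat * nat) := box_volume (G q.1 q.2).
have v0 q : 0 <= v q by exact: box_volume_ge0.
have /card_esym/ppcard_eqP[f] := card_nat2.
apply: (@le_trans _ _ (\sum_(k <oo) v (f k))).
  apply: ereal_inf_lbound; exists (fun k => G (f k).1 (f k).2) => //.
  move=> t [k _ /(PG k).1 [j _ Gt]]; exists (f^-1%FUN (k, j)) => //=.
  by rewrite invK ?inE.
rewrite nneseries_esumT//.
rewrite -(reindex_esum [set: nat] [set: nat * nat] f v)//.
rewrite (_ : [set: nat * nat] = setT `*`` (fun=> setT)); last first.
  by apply/seteqP; split.
rewrite -(@esum_esum _ _ _ setT (fun=> setT) (fun i j => v (i, j)))//.
rewrite nneseries_esumT//; last first.
  by move=> k; rewrite adde_ge0// ?lebesgue_outer_ge0// lee_fin.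
apply: le_esum => k _; rewrite -nneseries_esumT//.
exact: (PG k).2.
Qed.

HB.instance Definition _ := isOuterMeasure.Build R 'rV[R]_n lebesgue_outer
  lebesgue_outer0 lebesgue_outer_ge0 le_lebesgue_outer
  lebesgue_outer_sigma_subadditive.

End LebesgueOuterMeasure.

Notation lebesgue_type R n := (caratheodory_type (@lebesgue_outer R n)).

Definition lebesgue (R : realType) (n : nat) :
  set (lebesgue_type R n) -> \bar R := @lebesgue_outer R n.
HB.instance Definition _ (R : realType) (n : nat) :=
  isMeasure.Build _ _ _ (@lebesgue R n)
    (@caratheodory_measure0 _ _ (@lebesgue_outer R n))
    (@caratheodory_measure_ge0 _ _ (@lebesgue_outer R n))
    (@caratheodory_measure_sigma_additive _ _ (@lebesgue_outer R n)).

Section EssentialSup.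
Context {R : realType} {n : nat}.
Implicit Types (U : set 'rV[R]_n) (h : 'rV[R]_n -> \bar R).

Definition ess_sup_on U h : \bar R :=
  ess_sup (@lebesgue R n) (patch (fun=> -oo%E) U h).

Definition enorm m (x : 'rV[R]_m) : R := Num.sqrt (\sum_i x 0 i ^+ 2).

Definition eball (x : 'rV[R]_n) (e : R) : set 'rV[R]_n :=
  [set y | enorm (y - x) < e].

Definition ess_limsup U h (x : 'rV[R]_n) : \bar R :=
  lim (ess_sup_on (eball x e `&` U) h @[e --> 0^'+]).

Definition frontier U : set 'rV[R]_n := closure U `\` U°.

End EssentialSup.

Section Sobolev.
Context {R : realType} {n : nat}.
Implicit Types (U : set 'rV[R]_n) (f g phi : 'rV[R]_n -> R).
Implicit Types (alpha : seq 'I_n) (p : \bar R).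

Definition pderiv f alpha : 'rV[R]_n -> R :=
  foldr (fun i g x => 'D_('e_i) g x) f alpha.

Definition smooth f := forall alpha,
  continuous (pderiv f alpha) /\
  forall i x, derivable (pderiv f alpha) x 'e_i.

Definition test_function U phi :=
  [/\ smooth phi, compact (closure [set x | phi x != 0])
    & closure [set x | phi x != 0] `<=` U].

Definition loc_integrable U f := forall K, compact K -> K `<=` U ->
  (@lebesgue R n).-integrable K (EFin \o f).

Definition is_weak_deriv U f alpha g :=
  [/\ loc_integrable U f, loc_integrable U g
    & forall phi, test_function U phi ->
      (\int[@lebesgue R n]_(x in U) (f x * pderiv phi alpha x)%:E =
       ((-1) ^+ size alpha)%:E *
         \int[@lebesgue R n]_(x in U) (g x * phi x)%:E)%E].

(* A representative, unique up to a null subset of [U] when it exists. *)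
Definition weak_deriv U f alpha : 'rV[R]_n -> R :=
  xget (cst 0) [set g | is_weak_deriv U f alpha g].

Definition Lp_norm p U f : \bar R := 'N[@lebesgue R n]_p[EFin \o (f \_ U)]%E.

Definition Lp p U f :=
  measurable_fun (U : set (lebesgue_type R n)) f /\ (Lp_norm p U f < +oo)%E.

(* Vector-valued spaces W^{k,p}(U, R^N) and W^{k,p}_0(U, R^N); the latter is the
   closure of the test functions in the former. *)
Definition sobolev N k p U (u : 'rV[R]_n -> 'rV[R]_N) :=
  forall (a : 'I_N) alpha, (size alpha <= k)%N ->
    exists2 g, is_weak_deriv U (fun x => u x 0 a) alpha g & Lp p U g.

Definition sobolev0 N k p U (u : 'rV[R]_n -> 'rV[R]_N) :=
  sobolev k p U u /\
  forall a : 'I_N, exists2 phi : ('rV[R]_n -> R)^nat,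
    forall m, test_function U (phi m) &
    forall alpha, (size alpha <= k)%N ->
      Lp_norm p U (pderiv (phi m) alpha \- weak_deriv U (fun x => u x 0 a) alpha)
        @[m --> \oo] --> 0%E.

Definition sobolev_infty0 N k U (u : 'rV[R]_n -> 'rV[R]_N) :=
  sobolev k +oo%E U u /\ sobolev0 k 1%:E U u.

End Sobolev.

(** Coordinates of R^N x R^(Nn) x ... x R^(Nn^k): [Tagged _ (a, alpha)] with
    [alpha] a j-tuple is the entry of D^j u given by the iterated partial
    derivative along [alpha] of the component [a] of u. *)
Definition jet_index (n N k : nat) : finType :=
  {j : 'I_k.+1 & ('I_N * j.-tuple 'I_n)%type}.

Definition jet_dim (n N k : nat) : nat := #|jet_index n N k|.

Lemma jet_dimE n N k : jet_dim n N k = (N * \sum_(j < k.+1) n ^ j)%N.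
Proof.
rewrite /jet_dim card_tagged sumnE big_map big_enum big_distrr /=.
by apply: eq_bigr => j _; rewrite card_prod card_tuple !card_ord.
Qed.

Section Energy.
Context {R : realType} {n N k : nat}.
Implicit Types (U V : set 'rV[R]_n) (u : 'rV[R]_n -> 'rV[R]_N).
Implicit Type H : 'rV[R]_n -> 'rV[R]_(jet_dim n N k) -> R.

(* [V] is the open set on which the weak derivatives of [u] are taken. *)
Definition jet V u (x : 'rV[R]_n) : 'rV[R]_(jet_dim n N k) :=
  \row_(c < jet_dim n N k) let: (a, alpha) := tagged (enum_val c) in
    weak_deriv V (fun y => u y 0 a) alpha x.

Definition density H V u (x : 'rV[R]_n) : \bar R := (H x (jet V u x))%:E.

(* E_oo(u, U) for u in W^{k,oo}(V, R^N) and U included in V; the essential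
   supremum over a null set is -oo. *)
Definition energy H V u U : \bar R := ess_sup_on U (density H V u).

Definition absolute_minimiser H V u :=
  forall U phi, open U -> U `<=` V -> sobolev_infty0 k U phi ->
    (energy H V u U <= energy H U (u \+ phi)%R U)%E.

Definition caratheodory V H :=
  (forall X, measurable_fun (V : set (lebesgue_type R n)) (H ^~ X)) /\
  \forall x \ae @lebesgue R n, V x -> continuous (H x).

Definition radially_monotone V H := exists2 c : R * R -> R,
  [/\ {within `[0, 1] `*` `[0, +oo[, continuous c},
      forall t s, 0 <= t <= 1 -> 0 <= s -> 0 <= c (t, s),
      forall s, 0 <= s -> c (1, s) = 0,
      forall t, 0 <= t <= 1 -> c (t, 0) = 0
    & forall t s, 0 < t < 1 -> 0 < s -> 0 < c (t, s)] &
  forall t X, 0 <= t <= 1 -> \forall x \ae @lebesgue R n, V x ->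
    H x (t *: X) <= H x X - c (t, enorm X).

Definition uniform_modulus V H := forall r : R, 0 < r ->
  exists2 w : R -> R,
    [/\ {in `]0, +oo[ &, {homo w : s t / s <= t}},
        {in `]0, +oo[, continuous w} & w s @[s --> 0^'+] --> 0] &
    \forall x \ae @lebesgue R n, V x ->
      forall X Y, enorm X <= r -> enorm Y <= r -> X != Y ->
        `|H x X - H x Y| <= w (enorm (X - Y)).

End Energy.

(* Main.v *)
From HB Require Import structures.
Require Import Defs.
From mathcomp Require Import all_boot all_order all_algebra.
From mathcomp Require Import all_classical all_reals all_analysis.
From mathcomp Require Import ring lra measurable_realfun ess_sup_inf.

(** Suppose that the boundary supremum [S] is smaller than the essential supremum
    [E] of the energy density over [U]; the opposite strict inequality is excluded
    because the essential suprema that define the essential limsup are taken over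
    subsets of [U]. Choose [s] with [S < s < E]. By compactness of
    the frontier, the density is at most [s] almost everywhere in a collar of [U]
    along its frontier, and the complement [K] of the collar is compact in [U].
    Let [z] be a test function of [U] that is 1 near [K], and perturb [u] into
    [(1 - eps * z) * u].
    - In the collar the jet moves by [O (eps)], so by the modulus of continuity the
      density stays below a number smaller than [E].
    - Near [K] the jet is multiplied by [1 - eps]. Small jets have small density,
      since [H] vanishes at 0, and for the others the radial monotonicity lowers the
      density by a positive amount, uniform by compactness ([radial_gap]).
    Hence the perturbation has an energy smaller than [E], against minimality.

    It remains to see that the perturbation is admissible and that its jet is the
    expected one. The weak derivatives of [z * u] are found by moving
    derivatives onto test functions one at a time ([leibniz_weak]). That [z * u] is a
    limit of test functions in [W^(k,1)] is shown by mollification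
    ([variation_approximants]), which rests on the convergence of mollifications in
    [L^1] ([approximable_L1]): mollification is a contraction ([conv_contracts]), so
    convergence need only be checked on indicator functions of finite unions of
    boxes, where it is pointwise. The same convergence gives the uniqueness of weak
    derivatives ([is_weak_deriv_unique]), by which jets taken on different open sets
    are compared.

    The metric facts about the Lebesgue measure that enter are that the measure of a
    box is at most its volume, and translation invariance. The latter shows that either
    every nonempty open set has positive measure, or the measure vanishes
    ([negligible_open]); in the second case both sides of the principle are [-oo].
    Positivity is what makes mollifiers normalisable and [S] nonnegative, so that
    [s] is positive and bounds the density of small jets. *)

Set Implicit Arguments.
Unset Strict Implicit.
Unset Printing Implicit Defensive.

Import Order.TTheory GRing.Theory Num.Theory.
Import numFieldNormedType.Exports.

Local Open Scope classical_set_scope.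
Local Open Scope ring_scope.

(** * Lebesgue measure of boxes and of open sets *)

Section LebesgueBasics.
Context {R : realType} {n : nat}.
Local Notation V := 'rV[R]_n.
Local Notation T := (lebesgue_type R n).
Local Notation lam := (@lebesgue R n).
Implicit Types (A : set V) (a b x : V) (e : R).

Definition below (i : 'I_n) c : set V := [set x | x 0 i <= c].

Let cut_above i c x : V := \row_j if j == i then Num.min (x 0 j) c else x 0 j.
Let cut_below i c x : V := \row_j if j == i then Num.max (x 0 j) c else x 0 j.

Let box_below i c a b :
  box (Some (a, cut_above i c b)) = box (Some (a, b)) `&` below i c.
Proof.
apply/seteqP; split=> x /=.
  move=> h; split=> [j|]; last first.
    by have := h i; rewrite mxE eqxx le_min => /andP[_ /andP[]].
  have := h j; rewrite mxE; case: eqP => // _.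
  by rewrite le_min => /andP[-> /andP[-> _]].
move=> [h xc] j; rewrite mxE; case: eqP => // ->.
by rewrite le_min (andP (h i)).1 (andP (h i)).2.
Qed.

Let box_above i c a b :
  box (Some (cut_below i c a, b)) = box (Some (a, b)) `&` ~` below i c.
Proof.
apply/seteqP; split=> x /=.
  move=> h; split=> [j|]; last first.
    have := h i; rewrite mxE eqxx gt_max => /andP[/andP[_ + _]].
    by move=> cx xc; move: (lt_le_trans cx xc); rewrite ltxx.
  have := h j; rewrite mxE; case: eqP => // _.
  by rewrite gt_max => /andP[/andP[-> _] ->].
move=> [h /negP]; rewrite -ltNge => xc j; rewrite mxE; case: eqP => // ->.
by rewrite gt_max xc (andP (h i)).1 (andP (h i)).2.
Qed.

Let box_volume_cut i c a b :
  (box_volume (Some (a, b)) = box_volume (Some (a, cut_above i c b)) +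
                              box_volume (Some (cut_below i c a, b)))%E.
Proof.
rewrite -EFinD; congr EFin.
rewrite !(bigD1 (P := xpredT) i)//= !mxE eqxx.
set p := \prod_(j | _) _.
rewrite [X in _ * X + _](_ : _ = p); last first.
  by apply: eq_bigr => j /negPf ji; rewrite !mxE ji.
rewrite [X in _ + _ * X](_ : _ = p); last first.
  by apply: eq_bigr => j /negPf ji; rewrite !mxE ji.
rewrite -mulrDl; congr (_ * _).
rewrite /Num.max /Num.min.
case: (ltP (b 0 i) c); case: (ltP (a 0 i) c) => ? ?;
  by do ![case: ltP => ? //=]; lra.
Qed.

(** A coordinate half-space cuts each box of a cover into two boxes whose
    volumes add up, so it splits the outer measure of every set. *)
Lemma measurable_below i c : measurable (below i c : set T).
Proof.
apply: le_caratheodory_measurable => X.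
apply: le_ereal_inf_tmp => _ [F XF <-].
pose F1 k := if F k is Some (a, b) then Some (a, cut_above i c b) else None.
pose F2 k := if F k is Some (a, b) then Some (cut_below i c a, b) else None.
have F1E k : box (F1 k) = box (F k) `&` below i c.
  by rewrite /F1; case: (F k) => [[a b]|]; rewrite ?box_below//= set0I.
have F2E k : box (F2 k) = box (F k) `&` ~` below i c.
  by rewrite /F2; case: (F k) => [[a b]|]; rewrite ?box_above//= set0I.
rewrite (eq_eseriesr (g := fun k => box_volume (F1 k) + box_volume (F2 k))%E);
  last first.
  move=> k _; rewrite /F1 /F2; case: (F k) => [[a b]|]; last by rewrite adde0.
  exact: box_volume_cut.
rewrite nneseriesD; try by move=> *; exact: box_volume_ge0.
apply: leeD; apply: ereal_inf_lbound.
  exists F1 => // x [/XF[k _ Fx] xc]; exists k => //; by rewrite F1E.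
exists F2 => // x [/XF[k _ Fx] xc]; exists k => //; by rewrite F2E.
Qed.

Lemma measurable_box p : measurable (box p : set T).
Proof.
case: p => [[a b]|]; last exact: measurable0.
rewrite (_ : box _ = \bigcap_(i in [set: 'I_n])
    ((~` below i (a 0 i) `&` below i (b 0 i)) : set T)).
  apply: fin_bigcap_measurable => [|i _]; first exact: finite_finset.
  by apply: measurableI; [apply: measurableC|]; exact: measurable_below.
apply/seteqP; split=> x /=.
  move=> h i _; have /andP[ai bi] := h i; split=> //.
  by apply/negP; rewrite -ltNge.
move=> h i; have [/negP + ->] := h i I; by rewrite -ltNge => ->.
Qed.

(** Cover the box by itself. *)
Lemma lebesgue_box p : (lam (box p) <= box_volume p)%E.
Proof.
apply: (@le_trans _ _ (\sum_(k <oo) box_volume (if k == 0%N then p else None))%E).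
  by apply: ereal_inf_lbound; exists (fun k => if k == 0%N then p else None) => //;
    move=> x px; exists 0%N.
rewrite nneseries_recl//; last by move=> k _; exact: box_volume_ge0.
rewrite eqxx [X in (_ + X)%E]eseries0 ?adde0// => -[|k]//.
Qed.

Lemma rV_norm_lt (x : V) e : 0 < e -> (`|x| < e) = [forall i, `|x 0 i| < e].
Proof.
move=> e0; have -> : `|x| = mx_norm x by [].
rewrite mx_normrE; apply/idP/forallP.
  by move=> /bigmax_ltP[_ h] i; apply: (h (0, i)).
by move=> h; apply/bigmax_ltP; split=> // -[i j] _ /=; rewrite (ord1 i).
Qed.

Lemma rV_coord_le (x : V) i : `|x 0 i| <= `|x|.
Proof.
have -> : `|x| = mx_norm x by [].
by rewrite mx_normrE; apply: (le_bigmax _ (fun ij => `|x ij.1 ij.2|) (0, i)).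
Qed.

(** Boxes with rational corners form a countable base of the topology, which
    reduces topology to countable operations on boxes. *)
Definition rbox (c : 'rV[rat]_n * 'rV[rat]_n) : set V :=
  box (Some (map_mx ratr c.1, map_mx ratr c.2)).

Lemma rbox_nbhs x e : 0 < e -> exists q, rbox q x /\ rbox q `<=` ball x e.
Proof.
move=> e0.
have [p hp] : {p : 'I_n -> rat & forall i,
    x 0 i - e / 2 < ratr (p i) < x 0 i}.
  apply: (@choice _ _ (fun i q => x 0 i - e / 2 < ratr q < x 0 i)) => i.
  have : x 0 i - e / 2 < x 0 i by lra.
  by move=> /rat_in_itvoo[q]; rewrite in_itv/=; exists q.
have [q hq] : {q : 'I_n -> rat & forall i,
    x 0 i < ratr (q i) < x 0 i + e / 2}.
  apply: (@choice _ _ (fun i q => x 0 i < ratr q < x 0 i + e / 2)) => i.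
  have : x 0 i < x 0 i + e / 2 by lra.
  by move=> /rat_in_itvoo[r]; rewrite in_itv/=; exists r.
exists (\row_i p i, \row_i q i); split.
  move=> i; rewrite !mxE; have /andP[_ ->] := hp i.
  by have /andP[/ltW -> _] := hq i.
move=> y hy; rewrite -ball_normE /= rV_norm_lt//; apply/forallP => i.
have := hy i; rewrite !mxE; have := hp i; have := hq i; rewrite ltr_norml; lra.
Qed.

Lemma rational_dense (x : V) e : 0 < e ->
  exists q : 'rV[rat]_n, ball x e (map_mx ratr q).
Proof.
move=> e0; have [[p q] [cx ce]] := rbox_nbhs x e0; exists q.
apply: ce => i; rewrite lexx andbT.
by have := cx i; rewrite /=; case/andP; exact: lt_le_trans.
Qed.

Lemma open_rbox A : open A ->
  A = \bigcup_(c in [set c | rbox c `<=` A]) rbox c.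
Proof.
move=> oA; apply/seteqP; split=> [x Ax|x [c] /=]; last exact.
have /nbhs_ballP[e /= e0 eA] : nbhs x A by exact: open_nbhs_nbhs.
have [c [cx ce]] := rbox_nbhs x e0; exists c => //.
exact: subset_trans eA.
Qed.

Lemma measurable_open A : open A -> measurable (A : set T).
Proof.
move=> oA; rewrite (open_rbox oA) bigcup_mkcond.
apply: countable_bigcupT_measurable => [|c]; first exact: countableP.
by case: ifP => _; [exact: measurable_box|exact: measurable0].
Qed.

Lemma measurable_closed A : closed A -> measurable (A : set T).
Proof.
by move=> cA; rewrite -(setCK A); apply/measurableC/measurable_open/closed_openC.
Qed.

Lemma measurable_compact A : compact A -> measurable (A : set T).
Proof.
by move=> cA; apply: measurable_closed; exact: compact_closed.
Qed.

Lemma measurable_continuous (f : V -> R) :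
  continuous f -> measurable_fun (setT : set T) f.
Proof.
move=> /continuousP cf; apply: (measurability _ (RGenOpens.measurableE R)).
move=> _ [_ [a [b ->] <-]]; rewrite setTI; apply: measurable_open.
by apply: cf; exact: itv_open.
Qed.

(** The product sigma-algebra contains the open sets of the product topology,
    because the base of the product consists of countably many products of
    boxes. *)
Lemma measurable_open2 (W : set (V * V)) :
  open W -> measurable (W : set (T * T)).
Proof.
move=> oW; pose F q := rbox q.1 `*` rbox q.2.
have -> : W = \bigcup_(c in [set c | F c `<=` W]) F c.
  apply/seteqP; split=> [[x y] Wxy|[x y] [c /=]]; last exact.
  have [[P Q] /= [Px Qy] PQ] : nbhs (x, y) W by exact: open_nbhs_nbhs.
  move/nbhs_ballP : Px => [e /= e0 eP]; move/nbhs_ballP : Qy => [d /= d0 dQ].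
  have [c [cx ce]] := rbox_nbhs x e0; have [c' [cy ce']] := rbox_nbhs y d0.
  exists (c, c') => //= -[s t] [/= cs ct].
  by apply: PQ; split; [apply/eP/ce|apply/dQ/ce'].
rewrite bigcup_mkcond.
apply: countable_bigcupT_measurable => [|c]; first exact: countableP.
case: ifP => _; last exact: measurable0.
by apply: measurableX; exact: measurable_box.
Qed.

Lemma measurable_continuous2 (f : V * V -> R) :
  continuous f -> measurable_fun (setT : set (T * T)) f.
Proof.
move=> /continuousP cf; apply: (measurability _ (RGenOpens.measurableE R)).
move=> _ [_ [a [b ->] <-]]; rewrite setTI; apply: measurable_open2.
by apply: cf; exact: itv_open.
Qed.

End LebesgueBasics.

(** * Translation invariance and null sets *)

Section LebesgueInvariance.
Context {R : realType} {n : nat}.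
Local Notation V := 'rV[R]_n.
Local Notation T := (lebesgue_type R n).
Local Notation lam := (@lebesgue R n).
Implicit Types (A B : set V) (a b v x : V) (e : R).

Definition translate v : V -> V := +%R v.

Lemma lebesgue_outer_translate v A :
  lebesgue_outer (translate v @^-1` A) = lebesgue_outer A.
Proof.
have le w B : (lebesgue_outer (translate w @^-1` B) <= lebesgue_outer B)%E.
  apply: le_ereal_inf_tmp => _ [F BF <-]; apply: ereal_inf_lbound.
  pose G k := if F k is Some (a, b) then Some (a - w, b - w) else None.
  exists G.
    move=> x /BF[k _ Fx]; exists k => //; move: Fx; rewrite /G.
    case: (F k) => [[a b]|//] /= h i; have := h i.
    by rewrite !mxE lerBrDl ltrBlDl.
  apply: eq_eseriesr => k _; rewrite /G; case: (F k) => [[a b]|//] /=.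
  by congr EFin; apply: eq_bigr => i _; rewrite !mxE; congr (Num.max _ _); ring.
apply/eqP; rewrite eq_le le/=; apply: (le_trans _ (le (- v) _)).
by rewrite le_lebesgue_outer// => x /=; rewrite /translate addNKr.
Qed.

(** The outer measure is translation invariant, and the Caratheodory condition
    is expressed through the outer measure only. *)
Lemma measurable_translate v : measurable_fun (setT : set T) (translate v : T -> T).
Proof.
move=> _ A mA; rewrite setTI; apply: le_caratheodory_measurable => X.
have XE : X = translate v @^-1` (translate (- v) @^-1` X).
  by apply/seteqP; split=> x /=; rewrite /translate addKr.
pose Y := translate (- v) @^-1` X.
have YE : lebesgue_outer Y =
    (lebesgue_outer (Y `&` A) + lebesgue_outer (Y `&` ~` A))%E := mA Y.
have trE B : lebesgue_outer B = lebesgue_outer (translate v @^-1` B).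
  by rewrite lebesgue_outer_translate.
move: YE; rewrite (trE Y) (trE (Y `&` A)) (trE (Y `&` ~` A)).
rewrite !preimage_setI preimage_setC -XE => E.
by rewrite -[leRHS]/(lebesgue_outer X) E.
Qed.

Lemma ge0_integral_translate v (f : V -> \bar R) :
  measurable_fun (setT : set T) f -> (forall x, 0 <= f x)%E ->
  (\int[lam]_x f (translate v x) = \int[lam]_x f x)%E.
Proof.
move=> mf f0.
rewrite -[LHS](ge0_integral_pushforward (measurable_translate v) lam
  (D := setT))//.
apply: eq_measure_integral => [|mt A mA _]; first exact: measurable_translate.
exact: lebesgue_outer_translate.
Qed.

(** Completeness: a set of outer measure zero satisfies the Caratheodory
    condition. *)
Lemma negligible_outer A : lebesgue_outer A = 0%E -> lam.-negligible A.
Proof.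
move=> A0; exists A; split=> //; apply: le_caratheodory_measurable => X.
have XA0 : lebesgue_outer (X `&` A) = 0%E.
  apply/eqP; rewrite eq_le lebesgue_outer_ge0 andbT -[leRHS]A0.
  by apply: le_lebesgue_outer; exact: subIsetr.
have : (lebesgue_outer (X `&` A) + lebesgue_outer (X `&` ~` A) <=
    lebesgue_outer X)%E.
  by rewrite XA0 add0e; apply: le_lebesgue_outer; exact: subIsetl.
exact.
Qed.

(** The filter instance restated on the type of row vectors, where type-class
    resolution looks for it. *)
Global Instance lebesgue_ae_filter : @Filter V (almost_everywhere lam).
Proof. have F : Filter (almost_everywhere lam) by apply _.
exact F.
Qed.

Definition cube (r : R) : set V := box (Some (const_mx (- r), const_mx r)).

Lemma cube_sub (r : R) A : (forall x, A x -> `|x| < r) -> A `<=` cube r.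
Proof.
move=> Ar x Ax i; rewrite !mxE.
have := le_lt_trans (rV_coord_le x i) (Ar x Ax).
by rewrite ltr_norml => /andP[-> /ltW ->].
Qed.

Lemma lebesgue_bounded A : bounded_set A -> (lam A < +oo)%E.
Proof.
move=> [r [_ Ar]]; have : A `<=` cube (r + 2).
  by apply: cube_sub => x; move/(Ar (r + 1) _ x) => h; rewrite (le_lt_trans (h _)); lra.
move=> /le_lebesgue_outer h; apply: (le_lt_trans h).
by rewrite (le_lt_trans (lebesgue_box _))// ltry.
Qed.

Lemma lebesgue_sigma_finite : sigma_finite setT lam.
Proof.
exists (fun k => cube k.+1%:R).
  apply/esym/seteqP; split=> // x _; exists (Num.truncn `|x|) => //.
  apply: (@cube_sub _ [set x]) => // _ ->.
  exact: truncnS_gt.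
move=> k; split; first exact: measurable_box.
by rewrite (le_lt_trans (lebesgue_box _))// ltry.
Qed.

HB.instance Definition _ :=
  @Measure_isSigmaFinite.Build _ _ _ lam lebesgue_sigma_finite.

(** Each slab of thickness [e] around the hyperplane, cut by a cube, is covered
    by one box of volume proportional to [e]. *)
Lemma negligible_hyperplane (i : 'I_n) c :
  lam.-negligible [set x : V | x 0 i = c].
Proof.
rewrite (_ : [set x | _] = \bigcup_k ([set x : V | x 0 i = c] `&` cube k.+1%:R)).
  apply: negligible_bigcup => k; apply: negligible_outer.
  apply/eqP; rewrite eq_le lebesgue_outer_ge0 andbT.
  apply/lee_addgt0Pr => e e0; rewrite add0e.
  pose p : R := \prod_(j < n | j != i) (2 * k.+1%:R).
  have p0 : 0 < p by apply: prodr_gt0 => *; rewrite mulr_gt0.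
  pose a : V := \row_j if j == i then c - e / p else - k.+1%:R.
  pose b : V := \row_j if j == i then c else k.+1%:R.
  have sub : [set x : V | x 0 i = c] `&` cube k.+1%:R `<=` box (Some (a, b)).
    move=> x [/= xc h] j; rewrite !mxE; case: eqP => [->|_].
      by rewrite xc lexx ltrBlDr ltrDl divr_gt0.
    by have := h j; rewrite !mxE.
  apply: (le_trans (le_lebesgue_outer sub)); apply: (le_trans (lebesgue_box _)).
  rewrite lee_fin (bigD1 i)//= !mxE eqxx.
  rewrite (_ : c - (c - e / p) = e / p); last by ring.
  rewrite (max_idPr _); last by rewrite divr_ge0 ?ltW.
  rewrite (_ : \prod_(j | _) _ = p) ?divfK ?gt_eqF//.
  apply: eq_bigr => j /negPf ji; rewrite !mxE ji opprK -mulr2n mulr_natl.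
  by rewrite (max_idPr _)// mulrn_wge0.
apply/seteqP; split=> [x xc|x [k _ []]//].
exists (Num.truncn `|x|) => //; split=> //.
apply: (@cube_sub _ [set x]) => // _ ->; exact: truncnS_gt.
Qed.

(** A null ball has null translates, and countably many of them cover the
    space: either every nonempty open set has positive measure or the measure
    is zero. *)
Lemma negligible_open A B : open A -> A !=set0 -> lam.-negligible A ->
  lam.-negligible B.
Proof.
move=> oA [x Ax] A0.
have /nbhs_ballP[e /= e0 eA] : nbhs x A by exact: open_nbhs_nbhs.
have tA v : lam.-negligible (translate v @^-1` A).
  apply: negligible_outer; rewrite lebesgue_outer_translate.
  exact: (measure_negligible (mu := lam) (measurable_open oA) A0).
pose F k : set V := if unpickle k is Some q
  then translate (map_mx ratr (q : 'rV[rat]_n)) @^-1` A else set0.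
apply: (@negligibleS _ _ _ lam (\bigcup_k F k)); last first.
  apply: negligible_bigcup => k; rewrite /F.
  by case: unpickle => [q|]; [exact: tA|exact: negligible_set0].
move=> y _; have [q hq] := rational_dense (x - y) e0.
exists (pickle q) => //; rewrite /F pickleK /= /translate; apply: eA.
move: hq; rewrite -!ball_normE /= => hq.
by rewrite (_ : x - _ = x - y - map_mx ratr q)// opprD addrA addrAC.
Qed.

End LebesgueInvariance.

(** * Smooth functions *)

Section Smooth.
Context {R : realType} {n : nat}.
Local Notation V := 'rV[R]_n.
Implicit Types (f g psi : V -> R) (x v : V) (i : 'I_n) (al : seq 'I_n).

(** A directional derivative is a one-variable derivative along a line, so the
    one-variable chain rule applies to it. *)
Lemma is_derive_line f x v (t l : R) :
  is_derive (t *: v + x) v f l <-> is_derive t 1 (fun h => f (h *: v + x)) l.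
Proof.
have E : (fun h : R => h^-1 *: ((f \o shift (t *: v + x)) (h *: v) -
             f (t *: v + x))) =
   (fun h : R => h^-1 *: (((fun h => f (h *: v + x)) \o shift t) (h *: (1 : R)) -
             f (t *: v + x))).
  apply/funext => h /=; congr (_ *: (f _ - _)).
  by rewrite [h *: 1]mulr1 scalerDl addrA.
by split=> -[d1 d2]; split; move: d1 d2; rewrite /derivable /derive E.
Qed.

Lemma is_derive_mul (W : normedModType R) (f g : W -> R) (x v : W) a b :
  is_derive x v f a -> is_derive x v g b ->
  is_derive x v (f \* g) (a * g x + f x * b).
Proof.
move=> fa gb; apply: (is_derive_eq (is_deriveM fa gb)).
by rewrite addrC; congr (_ + _); rewrite [LHS]mulrC.
Qed.

(** Coinduction for smoothness: a class that is stable under one differentiation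
    contains all the iterated derivatives of its members. *)
Lemma smooth_coind (S : set (V -> R)) :
  (forall f, S f -> continuous f /\ forall i, exists2 g, S g &
     forall x, is_derive x ('e_i : V) f (g x)) ->
  S `<=` smooth.
Proof.
move=> HS f Sf al; have Spd : S (pderiv f al).
  elim: al => [//|i al IH] /=; have [_ /(_ i) [g Sg fg]] := HS _ IH.
  by rewrite (_ : (fun x => _) = g)//; apply/funext => x; have [_ ->] := fg x.
have [? d] := HS _ Spd; split=> // i x; have [g _ fg] := d i.
by have [] := fg x.
Qed.

Lemma pderiv_rcons f al i : pderiv f (rcons al i) = pderiv (pderiv f [:: i]) al.
Proof. by rewrite /pderiv foldr_rcons. Qed.

Lemma pderiv_cat f al be : pderiv f (al ++ be) = pderiv (pderiv f be) al.
Proof. by rewrite /pderiv foldr_cat. Qed.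

Lemma smooth_continuous f : smooth f -> continuous f.
Proof. by move=> /(_ [::]) []. Qed.

Lemma smooth_pderiv f al : smooth f -> smooth (pderiv f al).
Proof. by move=> sf be; rewrite -pderiv_cat; exact: sf. Qed.

Lemma smooth_derivable f i x : smooth f -> derivable f x 'e_i.
Proof. by move=> /(_ [::]) [_]; exact. Qed.

Lemma smooth_is_derive f i x : smooth f ->
  is_derive x ('e_i : V) f (pderiv f [:: i] x).
Proof. by move=> sf; split=> //; exact: smooth_derivable. Qed.

Inductive algebra_span (G : set (V -> R)) : set (V -> R) :=
| span_gen f of G f : algebra_span G f
| span_cst c : algebra_span G (cst c)
| span_add f g of algebra_span G f & algebra_span G g : algebra_span G (f \+ g)
| span_mul f g of algebra_span G f & algebra_span G g : algebra_span G (f \* g).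

(** Coinduction up to sums and products: by the product rule, only the
    generators have to be differentiated. *)
Lemma smooth_algebra_span (G : set (V -> R)) :
  (forall f, G f -> continuous f /\ forall i, exists2 g, algebra_span G g &
     forall x, is_derive x ('e_i : V) f (g x)) ->
  algebra_span G `<=` smooth.
Proof.
move=> HG; apply: smooth_coind => f; elim=> {f} [f|c|f g _ [cf df] _ [cg dg]
    |f g Sf [cf df] Sg [cg dg]].
- exact: HG.
- split; first exact: cst_continuous.
  by move=> i; exists (cst 0); [exact: span_cst|move=> x; exact: is_derive_cst].
- split; first by move=> x; apply: continuousD; [exact: cf|exact: cg].
  move=> i; have [f' Sf' ff'] := df i; have [g' Sg' gg'] := dg i.
  by exists (f' \+ g'); [exact: span_add|move=> x; exact: is_deriveD].
- split; first by move=> x; apply: continuousM; [exact: cf|exact: cg].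
  move=> i; have [f' Sf' ff'] := df i; have [g' Sg' gg'] := dg i.
  exists ((f' \* g) \+ (f \* g')).
    by apply: span_add; apply: span_mul.
  by move=> x; exact: is_derive_mul.
Qed.

Lemma smooth_span : algebra_span smooth `<=` @smooth R n.
Proof.
apply: smooth_algebra_span => f sf; split; first exact: smooth_continuous.
move=> i; exists (pderiv f [:: i]).
  by apply: span_gen; exact: smooth_pderiv.
by move=> x; exact: smooth_is_derive.
Qed.

Lemma smooth_cst c : smooth (cst c : V -> R).
Proof. by apply: smooth_span; exact: span_cst. Qed.

Lemma smoothM f g : smooth f -> smooth g -> smooth (f \* g).
Proof. by move=> sf sg; apply: smooth_span; apply: span_mul; exact: span_gen. Qed.

Lemma pderiv1M f g i x : smooth f -> smooth g ->
  pderiv (f \* g) [:: i] x = pderiv f [:: i] x * g x + f x * pderiv g [:: i] x.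
Proof.
move=> sf sg; rewrite /=.
by have [_ ->] := is_derive_mul (smooth_is_derive i x sf) (smooth_is_derive i x sg).
Qed.

Lemma is_derive_reflect f i x y l :
  is_derive (x - y) ('e_i : V) f l ->
  is_derive y ('e_i : V) (fun y => f (x - y)) (- l).
Proof.
move=> fl.
have {}fl : is_derive (- 0 : R) 1 (fun h => f (h *: 'e_i + (x - y))) l.
  by apply/is_derive_line; rewrite oppr0 scale0r add0r.
suff : is_derive (0 *: 'e_i + y) ('e_i : V) (fun y => f (x - y)) (- l).
  by rewrite scale0r add0r.
apply/is_derive_line.
rewrite (_ : (fun h => _) = (fun h => f (h *: 'e_i + (x - y))) \o -%R).
  apply: (is_derive_eq (is_derive1_comp fl (is_deriveNid _ _))).
  by rewrite mulrN1.
by apply/funext => h /=; rewrite scaleNr opprD addrCA.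
Qed.

Lemma continuous_reflect f x : continuous f -> continuous (fun y : V => f (x - y)).
Proof.
move=> cf y; apply: (@continuous_comp _ _ _ (fun y : V => x - y) f) => //.
  by apply: continuousB; [exact: cst_continuous|exact: cvg_id].
exact: cf.
Qed.

Lemma smooth_reflect f x : smooth f -> smooth (fun y => f (x - y)).
Proof.
move=> sf; pose S := [set g | exists c al, g = fun y : V => c * pderiv f al (x - y)].
have : S (fun y => f (x - y)) by exists 1, [::]; apply/funext => y; rewrite mul1r.
apply: smooth_coind => _ [c [al ->]]; split.
  move=> y; apply: (@cvgMl_tmp _ _ (nbhs (y : V))).
  exact/continuous_reflect/smooth_continuous/smooth_pderiv.
move=> i; exists (fun y => (- c) * pderiv f (i :: al) (x - y)).
  by exists (- c), (i :: al).
move=> y; rewrite mulNr -mulrN -[c * _]/(c *: _); apply: is_deriveZ.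
by apply: is_derive_reflect; exact: (smooth_is_derive i _ (smooth_pderiv al sf)).
Qed.

(** Each differentiation of the reflected function contributes one sign, the
    same sign that the weak formulation contributes. *)
Lemma pderiv_reflect f x al : smooth f ->
  pderiv (fun y => f (x - y)) al =
    (fun y => (-1) ^+ size al * pderiv f al (x - y)).
Proof.
move=> sf; elim: al => [|i al IH]; first by apply/funext => y; rewrite mul1r.
rewrite /= IH; apply/funext => y; apply: derive_val.
rewrite exprS mulN1r mulNr -mulrN; apply: is_deriveZ.
by apply: is_derive_reflect; exact: (smooth_is_derive i _ (smooth_pderiv al sf)).
Qed.

End Smooth.

(** * Flat exponentials *)

Section FlatExponential.
Context {R : realType}.

(** The functions [t ^ -m * exp (- 1 / t)], extended by 0 to the negative
    half-line, span a space that is closed under differentiation. *)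
Definition flat_exp m (t : R) : R :=
  if 0 < t then t^-1 ^+ m * expR (- t^-1) else 0.

(** From [exp y >= y ^ (m + 2) / (m + 2)!] at [y = 1 / t]. The square on the right
    makes the function differentiable at the origin, with derivative 0. *)
Lemma flat_exp_le m t : `|flat_exp m t| <= (m.+2)`!%:R * t ^+ 2.
Proof.
rewrite /flat_exp; case: ifPn => [t0|_]; last first.
  by rewrite normr0 mulr_ge0// sqr_ge0.
have y0 : 0 < t^-1 by rewrite invr_gt0.
have := expR_ge1Dxn m.+1 (ltW y0); set e := expR t^-1; set F := _%:R.
have F0 : 0 < F by rewrite ltr0n fact_gt0.
have e0 : 0 < e by exact: expR_gt0.
rewrite expRN -/e ger0_norm; last by rewrite mulr_ge0 ?exprn_ge0 ?invr_ge0 ?ltW.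
move=> h; rewrite ler_pdivrMr//.
have {}h : t^-1 ^+ m.+2 <= F * e.
  by rewrite mulrC -ler_pdivrMr//; apply: le_trans h; rewrite lerDr.
rewrite mulrAC -ler_pdivrMr ?exprn_gt0//; apply: le_trans h.
by rewrite -exprVn -exprD addn2.
Qed.

Lemma is_derive_eq_near (f g : R -> R) (x a b : R) :
  {near x, f =1 g} -> a = b -> is_derive x 1 f a -> is_derive x 1 g b.
Proof. by move=> fg <-; exact: near_eq_is_derive. Qed.

Lemma is_derive_flat_exp m (t : R) : is_derive t (1 : R) (flat_exp m)
  (flat_exp m.+2 t - m%:R * flat_exp m.+1 t).
Proof.
have [t0|t0|->] := ltgtP t 0.
- rewrite /flat_exp ltNge ltW//= mulr0 subr0.
  apply: (@near_eq_is_derive _ _ _ (cst 0)).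
  near=> s; rewrite ltNge (_ : s <= 0)//.
  by near: s; exact: (cvgr_le t).
- have tn0 : t != 0 by rewrite gt_eqF.
  have dV : is_derive t (1 : R) (fun s : R => s^-1) (- t ^- 2).
    apply: DeriveDef; first exact: derivableV.
    by rewrite deriveV// derive_id [LHS]mulr1.
  have dX : is_derive t (1 : R) ((fun s : R => s^-1) ^+ m)
      ((m%:R * t^-1 ^+ m.-1) *: - t ^- 2) by exact: is_deriveX.
  have dE : is_derive t (1 : R) (expR \o (fun s : R => - s^-1))
      (expR (- t^-1) * t ^- 2).
    apply: (@is_derive1_comp _ _ (fun s : R => - s^-1)).
    by rewrite -[t ^- 2]opprK; exact: is_deriveN.
  have := is_derive_mul dX dE; apply: is_derive_eq_near.
    near=> s; rewrite /flat_exp (_ : 0 < s)//= ?exprfctE//.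
    by near: s; exact: (cvgr_gt t).
  rewrite -[_ *: _]/(_ * _) /= /flat_exp t0 exprfctE.
  rewrite -(exprVn t 2); move: (t^-1) (expR _) => y z.
  by case: m dX => [|m] _; rewrite ?exprS /= ?expr0 ?expr1; ring.
- have cv : s^-1 *: ((flat_exp m \o shift 0) (s *: (1 : R)) - flat_exp m 0)
      @[s --> (0 : R)^'] --> (0 : R).
    pose C : R := (m.+2)`!%:R; have C0 : 0 < C by rewrite ltr0n fact_gt0.
    apply/cvgr0Pnorm_le => e e0; near=> s.
    have s0 : s != 0 by near: s; exact: nbhs_dnbhs_neq.
    rewrite /= addr0 [s *: 1]mulr1 [flat_exp m 0]/flat_exp ltxx subr0.
    rewrite normrM normfV mulrC ler_pdivrMr ?normr_gt0//.
    apply: (le_trans (flat_exp_le m s)); rewrite -/C -real_normK ?num_real//.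
    rewrite expr2 mulrA ler_wpM2r// -ler_pdivlMl// mulrC.
    by near: s; apply: dnbhs0_le; rewrite divr_gt0.
  rewrite /flat_exp ltxx mulr0 subr0; apply: DeriveDef.
    by apply/cvg_ex; exists 0.
  exact: cvg_lim cv.
Unshelve. all: by end_near. Qed.

End FlatExponential.

(** * Mollifiers *)

Section Mollifier.
Context {R : realType} {n : nat}.
Local Notation V := 'rV[R]_n.
Local Notation T := (lebesgue_type R n).
Local Notation lam := (@lebesgue R n).
Implicit Types (x y : V) (f : V -> R).

(** Powers of the argument times [exp (- 1 / t)], read along an affine
    coordinate [t = c + s * x_i]. *)
Definition flat_coord : set (V -> R) := [set f | exists m (c s : R) i,
  f = fun x : V => flat_exp m (c + s * x 0 i)].

Lemma smooth_flat_coord : algebra_span flat_coord `<=` @smooth R n.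
Proof.
apply: smooth_algebra_span => _ [m [c [s [i ->]]]]; split.
  move=> x; apply: (@continuous_comp _ _ _ (fun x : V => c + s * x 0 i)).
    apply: (@continuousD _ _ _ (cst c) (fun x : V => s * x 0 i)).
      exact: cst_continuous.
    apply: (@continuousM _ _ (cst s) (fun x : V => x 0 i)).
      exact: cst_continuous.
    exact: coord_continuous.
  apply: differentiable_continuous; apply/derivable1_diffP.
  by have [] := is_derive_flat_exp m (c + s * x 0 i).
move=> j; exists (cst (s * (i == j)%:R) \*
   ((fun x => flat_exp m.+2 (c + s * x 0 i)) \+
    (cst (- m%:R) \* (fun x => flat_exp m.+1 (c + s * x 0 i))))).
  apply: span_mul; first exact: span_cst.
  apply: span_add; first by apply: span_gen; exists m.+2, c, s, i.
  by apply: span_mul; [exact: span_cst|apply: span_gen; exists m.+1, c, s, i].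
move=> x; rewrite -[x in is_derive x](add0r x) -(scale0r ('e_j : V)).
apply/is_derive_line.
pose a : R := s * (i == j)%:R; pose b := c + s * x 0 i.
rewrite (_ : (fun h => _) = flat_exp m \o (fun h : R => a * h + b)); last first.
  apply/funext => h /=; congr flat_exp.
  by rewrite !mxE eqxx /= /a /b; ring.
have da : is_derive (0 : R) (1 : R) (fun h : R => a * h + b) a.
  have : is_derive (0 : R) (1 : R) ((a \*: id) + cst b) (a *: 1 + 0).
    exact: is_deriveD.
  by rewrite addr0 [X in is_derive _ _ _ X]mulr1.
apply: (is_derive_eq (is_derive1_comp (is_derive_flat_exp m _) da)).
by rewrite /= mulr0 add0r mulrC mulNr.
Qed.

Lemma span_prod (G : set (V -> R)) (I : Type) (r : seq I) (F : I -> V -> R) :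
  (forall i, algebra_span G (F i)) ->
  algebra_span G (fun x => \prod_(i <- r) F i x).
Proof.
move=> GF; elim: r => [|i r IH].
  rewrite (_ : (fun x => _) = cst 1); first exact: span_cst.
  by apply/funext => x; rewrite big_nil.
rewrite (_ : (fun x => _) = F i \* (fun x => \prod_(i <- r) F i x)).
  exact: span_mul.
by apply/funext => x; rewrite big_cons.
Qed.

(** In each coordinate a product of two flat exponentials that is positive exactly
    on [(- d, d)]; both signs occur, which makes the bump even. *)
Definition bump (d : R) (x : V) : R :=
  \prod_i (flat_exp 0 (d + 1 * x 0 i) * flat_exp 0 (d + (-1) * x 0 i)).

Lemma smooth_bump d : smooth (bump d).
Proof.
apply: smooth_flat_coord; apply: span_prod => i.
by apply: span_mul; apply: span_gen; [exists 0%N, d, 1, i|exists 0%N, d, (-1), i].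
Qed.

Lemma bump_even d x : bump d (- x) = bump d x.
Proof.
apply: eq_bigr => i _; rewrite !mxE mulrC; congr (flat_exp _ _ * flat_exp _ _); ring.
Qed.

Lemma flat_exp_ge0 m (t : R) : 0 <= flat_exp m t.
Proof.
rewrite /flat_exp; case: ifP => // t0.
by rewrite mulr_ge0 ?expR_ge0// exprn_ge0// invr_ge0 ltW.
Qed.

Lemma bump_ge0 d x : 0 <= bump d x.
Proof. by apply: prodr_ge0 => i _; rewrite mulr_ge0 ?flat_exp_ge0. Qed.

Lemma bump_gt0 d x : `|x| < d -> 0 < bump d x.
Proof.
move=> xd; apply: prodr_gt0 => i _.
have := le_lt_trans (rV_coord_le x i) xd; rewrite ltr_norml => /andP[h1 h2].
rewrite /flat_exp; do 2 (case: ifPn; last by lra).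
by move=> *; rewrite mulr_gt0// mulr_gt0 ?expR_gt0// expr0.
Qed.

Lemma bump_eq0 d x : 0 < d -> d <= `|x| -> bump d x = 0.
Proof.
move=> d0; rewrite leNgt rV_norm_lt// negb_forall => /existsP[i].
rewrite -leNgt => h; rewrite /bump (bigD1 i)//=.
rewrite (_ : flat_exp _ _ * flat_exp _ _ = 0) ?mul0r//.
move: h; rewrite ler_normr => /orP[] h; rewrite /flat_exp.
  by rewrite [X in _ * X]ifN ?mulr0//; lra.
by rewrite ifN ?mul0r//; lra.
Qed.

Lemma integrable_bounded (D : set V) f (M : R) :
  measurable (D : set T) -> bounded_set D -> measurable_fun (D : set T) f ->
  (forall x, D x -> `|f x| <= M) -> lam.-integrable D (EFin \o f).
Proof.
move=> mD bD mf fM; apply: measurable_bounded_integrable => //.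
  exact: lebesgue_bounded.
exists M; split; first exact: num_real.
by move=> r Mr x Dx; apply: (le_trans (fM x Dx)); exact: ltW.
Qed.

(** Functions with bounded support need only be integrated over a ball. *)
Lemma integrable_supported f (r M : R) :
  measurable_fun (setT : set T) f -> (forall x, `|f x| <= M) ->
  (forall x, r <= `|x| -> f x = 0) -> lam.-integrable setT (EFin \o f).
Proof.
move=> mf fM fr; pose D := [set x : V | `|x| < r].
have oD : open D.
  apply: (@open_comp _ _ (fun x : V => `|x|) [set y | y < r]).
    by move=> x _; exact: norm_continuous.
  exact: open_lt.
have -> : EFin \o f = (EFin \o f) \_ D.
  apply/funext => x; rewrite patchE; case: ifPn => //.
  by rewrite notin_setE /D /= => /negP; rewrite -leNgt => /fr /= ->.
apply/(integrable_mkcond (mu := lam) _ (measurable_open oD)).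
apply: (@integrable_bounded _ _ M) => //.
- exact: measurable_open.
- exists r; split; first exact: num_real.
  by move=> s rs x Dx; apply: ltW; exact: lt_trans rs.
- exact: measurable_funTS.
Qed.

Lemma bounded_supported f (r : R) : continuous f ->
  (forall x, r <= `|x| -> f x = 0) -> exists2 M, 0 <= M & forall x, `|f x| <= M.
Proof.
move=> cf fr; pose K := [set x : V | `|x| <= r].
have cK : compact K.
  apply: bounded_closed_compact.
    exists r; split; first exact: num_real.
    by move=> s rs x Dx; apply: ltW; exact: le_lt_trans rs.
  apply: (@closed_comp _ _ (fun x : V => `|x|) [set y | y <= r]).
    by move=> x _; exact: norm_continuous.
  exact: closed_le.
have : compact (f @` K).
  by apply: continuous_compact => //; exact: continuous_subspaceT.
move/compact_bounded => [M [_ hM]]; exists (`|M| + 1) => // x.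
have [xr|rx] := leP `|x| r.
  by apply: (hM (`|M| + 1)); [rewrite ltr_pwDr// ler_norm|exists x].
by rewrite fr ?normr0// ltW.
Qed.

(** The symmetry lets the unit mass be computed in either variable of
    [eta (x - y)]. *)
Definition is_mollifier (d : R) (eta : V -> R) :=
  [/\ smooth eta, forall x, 0 <= eta x, forall x, d <= `|x| -> eta x = 0,
      forall x, eta (- x) = eta x & (\int[lam]_x (eta x)%:E = 1)%E].

(** The normalisation divides by the integral of the bump, which is positive
    because the Lebesgue measure of a ball is. *)
Lemma mollifier_exists (d : R) : 0 < d -> ~ lam.-negligible [set: T] ->
  exists eta, is_mollifier d eta.
Proof.
move=> d0 nT.
have cb : continuous (bump d) by exact/smooth_continuous/smooth_bump.
have sb x : d <= `|x| -> bump d x = 0 by exact: bump_eq0.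
have mb : measurable_fun (setT : set T) (bump d) by exact: measurable_continuous.
have [M _ hM] := bounded_supported cb sb.
have ib : lam.-integrable setT (EFin \o bump d).
  by apply: (integrable_supported mb hM sb).
pose I := (\int[lam]_x (bump d x)%:E)%E.
have Ifin : I \is a fin_num by exact: integrable_fin_num.
have I0 : (0 <= I)%E by apply: integral_ge0 => x _; rewrite lee_fin bump_ge0.
have In0 : fine I != 0.
  apply/eqP => fI0; apply: nT.
  have : (\int[lam]_x `|(bump d x)%:E| = 0)%E.
    under eq_integral do rewrite gee0_abs ?lee_fin ?bump_ge0//.
    by rewrite -/I -[I]fineK// fI0.
  have mE : measurable_fun (setT : set T) (EFin \o bump d).
    exact/measurable_EFinP.
  move=> /(ae_eq_integral_abs lam measurableT mE) h.
  pose B := [set x : V | `|x| < d].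
  apply: (@negligible_open _ _ B) => //.
  - apply: (@open_comp _ _ (fun x : V => `|x|) [set y | y < d]).
      by move=> x _; exact: norm_continuous.
    exact: open_lt.
  - by exists 0; rewrite /B /= normr0.
  apply: negligibleS h => x /= /bump_gt0 bx /(_ Logic.I) [] bx0.
  by rewrite bx0 ltxx in bx.
exists (fun x => (fine I)^-1 * bump d x); split.
- by apply: (@smoothM _ _ (cst _)); [exact: smooth_cst|exact: smooth_bump].
- by move=> x; rewrite mulr_ge0 ?bump_ge0// invr_ge0 fine_ge0.
- by move=> x /sb ->; rewrite mulr0.
- by move=> x; rewrite bump_even.
under eq_integral do rewrite EFinM.
rewrite (integralZl _ ib)//.
by rewrite -/I -[X in (_ * X)%E]fineK// -EFinM mulVf.
Qed.

End Mollifier.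

(** * Convolution with a smooth kernel *)

Section Convolution.
Context {R : realType} {n : nat}.
Local Notation V := 'rV[R]_n.
Local Notation T := (lebesgue_type R n).
Local Notation lam := (@lebesgue R n).
Local Notation L1 f := (lam.-integrable setT (EFin \o f)).
Implicit Types (x y : V) (f g psi : V -> R).

Definition conv f psi x : R := (\int[lam]_y (f y * psi (x - y)))%R.

Definition bounded_support psi := exists r, forall x, r <= `|x| -> psi x = 0.

Lemma integrable_conv_integrand f psi x M : L1 f -> continuous psi ->
  (forall x, `|psi x| <= M) -> L1 (fun y => f y * psi (x - y)).
Proof.
move=> If cpsi psiM.
apply: (@integrableMl _ T R lam setT measurableT (EFin \o f)
  (fun y => psi (x - y)) If).
  exact/measurable_continuous/continuous_reflect.
exists M; split; first exact: num_real.
by move=> s Ms y _; apply: (le_trans (psiM _)); exact: ltW.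
Qed.

Lemma measurable_L1 f : L1 f -> measurable_fun (setT : set T) f.
Proof. by move=> /measurable_int /measurable_EFinP. Qed.

Lemma near_dist_lt x e : 0 < e -> \forall y \near x, `|x - y| < e.
Proof. by move=> e0; have := nbhsx_ballx x e e0; rewrite -ball_normE. Qed.

(** Continuity through sequences, the form in which dominated convergence gives
    it. *)
Lemma continuous_seq f x :
  (forall u : nat -> V, u k @[k --> \oo] --> x -> f (u k) @[k --> \oo] --> f x) ->
  {for x, continuous f}.
Proof.
move=> H; apply/(@cvgrPdist_lt _ _ _ (nbhs x)) => e e0; apply: contrapT => ne.
have /choice[u hu] : forall k : nat, exists y, `|x - y| < k.+1%:R^-1 /\
    e <= `|f x - f y|.
  move=> k; apply: contrapT => /forallNP h; apply: ne.
  have k0 : 0 < k.+1%:R^-1 :> R by rewrite invr_gt0.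
  apply: (@filterS _ (nbhs x) _ _ _ _ (near_dist_lt x k0)) => y xy.
  by rewrite ltNge; apply/negP => ey; exact: (h y).
have ux : u k @[k --> \oo] --> x.
  apply/cvgrPdist_lt => d d0; near=> k.
  apply: lt_trans (hu k).1 _; near: k.
  exact: (near_infty_natSinv_lt (PosNum d0)).
move/cvgrPdist_lt : (H _ ux) => /(_ _ e0) [k _ /(_ k)] /=.
by rewrite leqnn => /(_ isT); rewrite ltNge (hu k).2.
Unshelve. all: by end_near. Qed.

Lemma continuous_conv f psi : L1 f -> continuous psi -> bounded_support psi ->
  continuous (conv f psi).
Proof.
move=> If cpsi [r psir] x; have [M M0 psiM] := bounded_supported cpsi psir.
apply: continuous_seq => u ux.
have Ic y := integrable_conv_integrand y If cpsi psiM.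
apply: (@fine_cvg _ _ _ _ (fun k => (\int[lam]_y (f y * psi (u k - y))%:E)%E)).
rewrite fineK; last by apply: integrable_fin_num; [|exact: Ic].
have [|||||//] := @dominated_convergence _ T R lam setT measurableT
  (fun k y => (f y * psi (u k - y))%:E) (fun y => (f y * psi (x - y))%:E)
  (fun y => (M * `|f y|)%:E).
- by move=> k; exact: measurable_int (Ic (u k)).
- exact: measurable_int (Ic x).
- apply: aeW => y _; apply: cvg_EFin; first exact: nearW.
  have cy : u k - y @[k --> \oo] --> x - y by apply: cvgB => //; exact: cvg_cst.
  by apply: cvgMl_tmp; exact: (cvg_comp _ _ cy (cpsi (x - y))).
- rewrite (_ : (fun y => _) = (fun y => M%:E * `|(f y)%:E|)%E) //.
  by apply: integrableZl => //; exact: integrable_abse.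
- apply: aeW => y k _; rewrite lee_fin normrM mulrC ler_wpM2r//.
Qed.

(** The support does not grow; the radius [r + 1] leaves a neighbourhood on which
    the function vanishes. *)
Lemma pderiv_supported psi r i : (forall x, r <= `|x| -> psi x = 0) ->
  forall x, r + 1 <= `|x| -> pderiv psi [:: i] x = 0.
Proof.
move=> psir x rx; rewrite /= -[RHS](derive_cst 0 x 'e_i).
apply: near_eq_derive; apply: (@filterS _ (nbhs x) _ _ _ _ (near_dist_lt x ltr01)) => y xy.
apply: psir; have := ler_normD (x - y) y; rewrite subrK; lra.
Qed.

(** Differentiation under the integral, dominated by [f] times a bound of the
    derivative of the kernel. *)
Lemma is_derive_conv f psi i x : L1 f -> smooth psi -> bounded_support psi ->
  is_derive x ('e_i : V) (conv f psi) (conv f (pderiv psi [:: i]) x).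
Proof.
move=> If spsi [r psir]; have cpsi := smooth_continuous spsi.
have [M M0 psiM] := bounded_supported cpsi psir.
have sdpsi := smooth_pderiv [:: i] spsi.
have cdpsi := smooth_continuous sdpsi.
have [K K0 dpsiK] := bounded_supported cdpsi (pderiv_supported i psir).
rewrite -[X in is_derive X](add0r x) -(scale0r ('e_i : V)).
apply/is_derive_line.
pose F (h : R) y := f y * psi (h *: 'e_i + x - y).
have dF h y : is_derive h (1 : R) (F ^~ y)
    (f y * pderiv psi [:: i] (h *: 'e_i + x - y)).
  rewrite -[f y * _]/(f y *: _); apply: is_deriveZ.
  rewrite (_ : (fun h => _) = (fun h : R => psi (h *: 'e_i + (x - y)))).
    by apply/is_derive_line; rewrite addrA; exact: smooth_is_derive.
  by apply/funext => s; rewrite addrA.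
have d1F h y : partial1of2 F h y = f y * pderiv psi [:: i] (h *: 'e_i + x - y).
  by rewrite partial1of2E; have [] := dF h y.
have I0 : (`]-1, 1[%classic : set R) 0 by rewrite /= in_itv/= ltrN10 ltr01.
have IF (h : R) : `]-1, 1[%classic h -> L1 (F h).
  by move=> _; exact: integrable_conv_integrand If cpsi psiM.
have derF (h : R) y : `]-1, 1[%classic h -> [set: T] y -> derivable (F ^~ y) h 1.
  by move=> _ _; have [] := dF h y.
pose G y := K * `|f y|.
have G0 y : 0 <= G y by rewrite mulr_ge0.
have IG : L1 G.
  rewrite (_ : _ \o _ = (fun y => K%:E * `|(f y)%:E|)%E) //.
  by apply: integrableZl => //; exact: integrable_abse.
have GF (h : R) y : `]-1, 1[%classic h -> [set: T] y -> `|partial1of2 F h y| <= G y.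
  by move=> _ _; rewrite d1F normrM mulrC ler_wpM2r.
split; first exact: (derivable_under_integral measurableT I0 IF derF G0 IG GF).
rewrite -derive1E.
rewrite (differentiation_under_integral measurableT I0 IF derF G0 IG GF).
by apply: eq_Rintegral => y _; rewrite d1F scale0r add0r.
Qed.

Lemma smooth_conv f psi : L1 f -> smooth psi -> bounded_support psi ->
  smooth (conv f psi).
Proof.
move=> If spsi bpsi.
pose S := [set g | exists2 h, smooth h /\ bounded_support h & g = conv f h].
apply: (@smooth_coind _ _ S); last by exists psi.
move=> _ [h [sh bh] ->]; split.
  by apply: continuous_conv => //; exact: smooth_continuous.
move=> i; exists (conv f (pderiv h [:: i])).
  exists (pderiv h [:: i]); last by [].
  split; first exact: smooth_pderiv.
  by have [r hr] := bh; exists (r + 1); exact: pderiv_supported.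
by move=> x; exact: is_derive_conv.
Qed.

Lemma pderiv_conv f psi al x : L1 f -> smooth psi -> bounded_support psi ->
  pderiv (conv f psi) al x = conv f (pderiv psi al) x.
Proof.
move=> If; elim/last_ind: al psi => [//|al i IH] psi spsi bpsi.
rewrite !pderiv_rcons -IH; last 2 first.
- exact: smooth_pderiv.
- by have [r hr] := bpsi; exists (r + 1); exact: pderiv_supported.
congr pderiv; apply/funext => y.
by have [_] := is_derive_conv i y If spsi bpsi.
Qed.

End Convolution.
Arguments conv {R n} (f psi)%_ring_scope x.

(** * Mollification is a contraction of the space of integrable functions *)

Section L1Mollification.
Context {R : realType} {n : nat}.
Local Notation V := 'rV[R]_n.
Local Notation T := (lebesgue_type R n).
Local Notation lam := (@lebesgue R n).
Local Notation L1 f := (lam.-integrable setT (EFin \o f)).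
Implicit Types (x y : V) (f g : V -> R) (d : R).

Lemma L1D f g : L1 f -> L1 g -> L1 (f \+ g).
Proof. by move=> If Ig; have := integrableD measurableT If Ig. Qed.

Lemma L1B f g : L1 f -> L1 g -> L1 (f \- g).
Proof. by move=> If Ig; have := integrableB measurableT If Ig. Qed.

Lemma L1Z c f : L1 f -> L1 (fun x => c * f x).
Proof. by move=> If; have := integrableZl measurableT c If. Qed.

Section OneMollifier.
Variables (d : R) (eta : V -> R).
Hypothesis eta_mollifier : is_mollifier d eta.

Let seta : smooth eta. Proof. by case: eta_mollifier. Qed.
Let eta0 x : 0 <= eta x. Proof. by case: eta_mollifier. Qed.
Let etad x : d <= `|x| -> eta x = 0. Proof. by case: eta_mollifier => ? ? + _ _; exact. Qed.
Let eta_even x : eta (- x) = eta x. Proof. by case: eta_mollifier. Qed.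
Let int_eta : (\int[lam]_x (eta x)%:E = 1)%E. Proof. by case: eta_mollifier. Qed.
Let ceta : continuous eta. Proof. exact: smooth_continuous. Qed.
Let meta : measurable_fun (setT : set T) (EFin \o eta).
Proof. exact/measurable_EFinP/measurable_continuous. Qed.

Lemma mollifier_supported : bounded_support eta.
Proof. by exists d. Qed.

Lemma integral_mollifier_l y : (\int[lam]_x (eta (x - y))%:E = 1)%E.
Proof.
rewrite -int_eta -[RHS](ge0_integral_translate (- y) meta); last first.
  by move=> x; rewrite lee_fin.
by apply: eq_integral => x _; rewrite /translate /= addrC.
Qed.

Lemma integral_mollifier_r x : (\int[lam]_y (eta (x - y))%:E = 1)%E.
Proof.
rewrite -(integral_mollifier_l x); apply: eq_integral => y _.
by rewrite -eta_even opprB.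
Qed.

Lemma L1_conv_integrand f x : L1 f -> L1 (fun y => f y * eta (x - y)).
Proof.
move=> If; have [M _ etaM] := bounded_supported ceta etad.
exact: integrable_conv_integrand If ceta etaM.
Qed.

Lemma L1_mollifier x : L1 (fun y => eta (x - y)).
Proof.
apply/integrableP; split.
  exact/measurable_EFinP/measurable_continuous/continuous_reflect.
under eq_integral do rewrite /= ger0_norm//.
by rewrite integral_mollifier_r ltry.
Qed.

Lemma convD f g x : L1 f -> L1 g ->
  conv (f \+ g) eta x = conv f eta x + conv g eta x.
Proof.
move=> If Ig; rewrite /conv -RintegralD//; try exact: L1_conv_integrand.
by apply: eq_Rintegral => y _; rewrite mulrDl.
Qed.

Lemma convZ c f x : L1 f -> conv (fun y => c * f y) eta x = c * conv f eta x.
Proof.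
move=> If; rewrite /conv -RintegralZl//; last exact: L1_conv_integrand.
by apply: eq_Rintegral => y _; rewrite mulrA.
Qed.

Lemma convB f g x : L1 f -> L1 g ->
  conv (f \- g) eta x = conv f eta x - conv g eta x.
Proof.
move=> If Ig; rewrite /conv -RintegralB//; try exact: L1_conv_integrand.
by apply: eq_Rintegral => y _; rewrite mulrBl.
Qed.

Lemma EFin_conv f x : L1 f ->
  (conv f eta x)%:E = (\int[lam]_y (f y * eta (x - y))%:E)%E.
Proof.
move=> If; rewrite /conv /Rintegral fineK//.
by apply: integrable_fin_num => //; exact: L1_conv_integrand.
Qed.

(** Young's inequality with the unit mass of the mollifier: exchange the two
    integrations and integrate the mollifier first. *)
Lemma conv_contracts f : L1 f ->
  (\int[lam]_x `|(conv f eta x)%:E| <= \int[lam]_x `|(f x)%:E|)%E.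
Proof.
move=> If.
pose F (z : T * T) := (`|f z.2| * eta (z.1 - z.2))%:E.
have mF : measurable_fun (setT : set (T * T)) F.
  apply/measurable_EFinP; apply: measurable_funM.
    have mf : measurable_fun (setT : set T) (fun y => `|f y|).
      by apply: measurableT_comp (measurable_L1 If); exact: normr_measurable.
    exact: (measurableT_comp mf measurable_snd).
  apply: (@measurable_continuous2 R n (fun z => eta (z.1 - z.2))) => z.
  apply: (@continuous_comp _ _ _ (fun z : V * V => z.1 - z.2) eta) => //.
    by apply: continuousB; [exact: cvg_fst|exact: cvg_snd].
  exact: ceta.
have F0 z : (0 <= F z)%E by rewrite lee_fin mulr_ge0.
have mconv : measurable_fun (setT : set T) (EFin \o conv f eta).
  apply/measurable_EFinP; apply: measurable_continuous.
  by apply: continuous_conv => //; exact: mollifier_supported.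
have step1 : (\int[lam]_x `|(conv f eta x)%:E| <=
    \int[lam]_x \int[lam]_y F (x, y))%E.
  apply: (ge0_le_integral lam measurableT).
  - by move=> x _; exact: abse_ge0.
  - by apply: measurableT_comp mconv; exact: abse_measurable.
  - exact: (measurable_fun_fubini_tonelli_F (m2 := lam) F mF F0).
  - move=> x _; rewrite EFin_conv//.
    have mi := measurable_int _ (L1_conv_integrand x If).
    apply: (le_trans (le_abse_integral lam measurableT mi)).
    rewrite le_eqVlt; apply/orP; left; apply/eqP; apply: eq_integral => y _.
    by rewrite /F /= normrM (ger0_norm (eta0 _)).
apply: (le_trans step1).
rewrite (fubini_tonelli (m1 := lam) (m2 := lam) F mF F0).
rewrite le_eqVlt; apply/orP; left; apply/eqP; apply: eq_integral => y _.
rewrite /F /=; under eq_integral do rewrite EFinM.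
have me : measurable_fun (setT : set T) (fun x => (eta (x - y))%:E).
  apply/measurable_EFinP; apply: measurable_continuous => x.
  apply: (@continuous_comp _ _ _ (fun x : V => x - y) eta).
    by apply: continuousB; [exact: cvg_id|exact: cst_continuous].
  exact: ceta.
rewrite (ge0_integralZl lam measurableT me).
- by rewrite integral_mollifier_l mule1.
- by move=> x _; rewrite lee_fin.
- by rewrite lee_fin.
Qed.

Lemma L1_conv f : L1 f -> L1 (conv f eta).
Proof.
move=> If; apply/integrableP; split.
  apply/measurable_EFinP; apply: measurable_continuous.
  by apply: continuous_conv => //; exact: mollifier_supported.
apply: le_lt_trans (conv_contracts If) _.
by have /integrableP[] := If.
Qed.

Lemma conv_locally_constant f x : L1 f -> (forall y, `|x - y| < d -> f y = f x) ->
  conv f eta x = f x.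
Proof.
move=> If fx; rewrite /conv.
have -> : (\int[lam]_y (f y * eta (x - y)))%R =
    (\int[lam]_y (f x * eta (x - y)))%R.
  apply: eq_Rintegral => y _; have [/fx ->//|/etad ->] := ltP `|x - y| d.
  by rewrite !mulr0.
have Ie := L1_mollifier x.
by rewrite RintegralZl// /Rintegral integral_mollifier_r mulr1.
Qed.

Lemma conv_eq0 f r x : (forall y, r <= `|y| -> f y = 0) -> r + d <= `|x| ->
  conv f eta x = 0.
Proof.
move=> fr rx; rewrite -[RHS](_ : (\int[lam]_(y in setT) (cst 0 y))%R = 0); last first.
  by rewrite /Rintegral integral0.
apply: eq_Rintegral => y _; have [/fr ->|yr] := leP r `|y|.
  by rewrite mul0r.
rewrite etad ?mulr0//; have := ler_normD (x - y) y; rewrite subrK; lra.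
Qed.

Lemma conv_bounded f x M : L1 f -> (forall y, `|f y| <= M) -> `|conv f eta x| <= M.
Proof.
move=> If fM; rewrite -lee_fin.
have Ic := L1_conv_integrand x If.
have Ie := L1_mollifier x.
apply: (@le_trans _ _ (\int[lam]_y `|f y * eta (x - y)|)%R%:E).
  by rewrite lee_fin; exact: le_normr_Rintegral.
rewrite -[leRHS](_ : (\int[lam]_y (M * eta (x - y)))%R%:E = _); last first.
  by rewrite RintegralZl// /Rintegral integral_mollifier_r mulr1.
rewrite lee_fin; apply: le_Rintegral => //.
- by have := integrable_abse Ic.
- exact: L1Z.
- by move=> y _; rewrite normrM (ger0_norm (eta0 _)) ler_wpM2r.
Qed.

End OneMollifier.
End L1Mollification.

(** * Functions approximated by their mollifications *)

Section L1Approximation.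
Context {R : realType} {n : nat}.
Local Notation V := 'rV[R]_n.
Local Notation T := (lebesgue_type R n).
Local Notation lam := (@lebesgue R n).
Local Notation L1 f := (lam.-integrable setT (EFin \o f)).
Implicit Types (x y : V) (f g : V -> R) (A : set V).

(** Convergence to 0 of nonnegative extended reals, without the detour through
    finite parts. *)
Lemma cvge0P (u : nat -> \bar R) : (forall k, 0 <= u k)%E ->
  u k @[k --> \oo] --> 0%E <->
  forall e : R, 0 < e -> \forall k \near \oo, (u k <= e%:E)%E.
Proof.
move=> u0; split=> [/fine_cvgP[ufin /cvgr0Pnorm_le u_cvg] e e0|ue].
  near=> k; have uk : u k \is a fin_num by near: k.
  rewrite -(fineK uk) lee_fin (le_trans (ler_norm _))//.
  by near: k; exact: u_cvg.
apply/fine_cvgP; split.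
  near=> k; rewrite ge0_fin_numE//; apply: le_lt_trans (ltry 1).
  by near: k; exact: ue.
apply/cvgr0Pnorm_le => e e0; near=> k.
have uke : (u k <= e%:E)%E by near: k; exact: ue.
rewrite /= ger0_norm ?fine_ge0// -lee_fin fineK//.
by rewrite ge0_fin_numE//; exact: le_lt_trans uke (ltry _).
Unshelve. all: by end_near. Qed.

Definition L1norm f : \bar R := (\int[lam]_x `|(f x)%:E|)%E.

Arguments L1norm f%_ring_scope.

Lemma L1norm_ge0 f : (0 <= L1norm f)%E.
Proof. by apply: integral_ge0 => x _; exact: abse_ge0. Qed.

Lemma measurable_abs_L1 f : L1 f ->
  measurable_fun (setT : set T) (fun x => `|(f x)%:E|)%E.
Proof.
by move=> If; apply: measurableT_comp (measurable_int _ If); exact: abse_measurable.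
Qed.

Lemma L1norm_triangle f g h : L1 f -> L1 g -> L1 h ->
  (forall x, `|f x| <= `|g x| + `|h x|) -> (L1norm f <= L1norm g + L1norm h)%E.
Proof.
move=> If Ig Ih fgh; rewrite /L1norm -(ge0_integralD lam measurableT).
- apply: (ge0_le_integral lam measurableT).
  + by move=> x _; exact: abse_ge0.
  + exact: measurable_abs_L1.
  + by apply: emeasurable_funD; exact: measurable_abs_L1.
  + by move=> x _; rewrite /= -EFinD lee_fin.
- by move=> x _; exact: abse_ge0.
- exact: measurable_abs_L1.
- by move=> x _; exact: abse_ge0.
- exact: measurable_abs_L1.
Qed.

Lemma L1norm_indic A : measurable (A : set T) -> L1norm (\1_A) = lam A.
Proof.
move=> mA; rewrite /L1norm; under eq_integral do rewrite gee0_abs ?lee_fin//.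
by rewrite integral_indic// setIT.
Qed.

Lemma L1_indic A : measurable (A : set T) -> (lam A < +oo)%E -> L1 (\1_A).
Proof.
move=> mA Afin; apply/integrableP; split; last by rewrite -[ltLHS]/(L1norm _) L1norm_indic.
exact/measurable_EFinP/measurable_indic.
Qed.

Variable eta : nat -> V -> R.
Hypothesis eta_mollifier : forall k, is_mollifier k.+1%:R^-1 (eta k).

(** Convergence of the mollifications, in the form in which closedness of the
    class under sums and limits is a matter of adding errors. *)
Definition approximable f := L1 f /\ forall e, 0 < e -> \forall k \near \oo,
  (L1norm (f \- conv f (eta k)) <= e%:E)%E.

Let L1c k f : L1 f -> L1 (conv f (eta k)).
Proof. exact: (L1_conv (eta_mollifier k)). Qed.

Lemma approximable0 : approximable (cst 0).
Proof.
split; first exact: integrable0.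
move=> e e0; apply: nearW => k; rewrite /L1norm (eq_integral (cst 0%E)).
  by rewrite integral0 lee_fin ltW.
move=> x _ /=; suff -> : conv (cst 0) (eta k) x = 0 by rewrite subrr normr0.
transitivity (\int[lam]_(y in [set: T]) (cst 0 y : R))%R.
  by apply: eq_Rintegral => y _; rewrite /= mul0r.
by rewrite /Rintegral integral0.
Qed.

Lemma approximableD f g : approximable f -> approximable g ->
  approximable (f \+ g).
Proof.
move=> [If f_cvg] [Ig g_cvg]; split; first exact: L1D.
move=> e e0; have e2 : 0 < e / 2 by rewrite divr_gt0.
apply: filterS2 (f_cvg _ e2) (g_cvg _ e2) => k fk gk.
apply: (@le_trans _ _ ((e / 2)%:E + (e / 2)%:E)%E); last first.
  by rewrite -EFinD lee_fin; lra.
apply: (@le_trans _ _ (L1norm (f \- conv f (eta k)) + L1norm (g \- conv g (eta k)))%E).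
  apply: L1norm_triangle.
  - by apply: L1B; [exact: L1D|exact/L1c/L1D].
  - by apply: L1B => //; exact: L1c.
  - by apply: L1B => //; exact: L1c.
  move=> x; rewrite /= (convD (eta_mollifier k))//.
  by rewrite (_ : _ - _ = (f x - conv f (eta k) x) + (g x - conv g (eta k) x));
    [exact: ler_normD|ring].
exact: (leeD fk gk).
Qed.

Lemma approximableZ c f : approximable f -> approximable (fun x => c * f x).
Proof.
move=> [If f_cvg]; split; first exact: L1Z.
move=> e e0; have c1 : 0 < `|c| + 1 by rewrite ltr_pwDr.
have ec : 0 < e / (`|c| + 1) by rewrite divr_gt0.
near=> k; have fk : (L1norm (f \- conv f (eta k)) <= (e / (`|c| + 1))%:E)%E.
  by near: k; exact: f_cvg.
apply: (@le_trans _ _ (`|c|%:E * L1norm (f \- conv f (eta k)))%E).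
  rewrite /L1norm -(ge0_integralZl lam measurableT).
  - rewrite le_eqVlt; apply/orP; left; apply/eqP; apply: eq_integral => x _.
    by rewrite /= (convZ (eta_mollifier k))// -mulrBr normrM EFinM.
  - by apply: measurable_abs_L1; apply: L1B => //; exact: L1c.
  - by move=> x _; exact: abse_ge0.
  - by rewrite lee_fin.
apply: le_trans (lee_wpmul2l _ fk) _; first by rewrite lee_fin.
rewrite -EFinM lee_fin mulrCA ger_pMr// ler_pdivrMr// mul1r; lra.
Unshelve. all: by end_near. Qed.

(** The class of integrable functions that their mollifications approximate is
    closed in [L^1], because mollification is a contraction. *)
Lemma approximable_limit f : L1 f ->
  (forall e, 0 < e -> exists2 g, approximable g & (L1norm (f \- g) <= e%:E)%E) ->
  approximable f.
Proof.
move=> If fg; split=> // e e0; have e3 : 0 < e / 3 by rewrite divr_gt0.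
have [g [Ig g_cvg] fge] := fg _ e3; near=> k.
have gk : (L1norm (g \- conv g (eta k)) <= (e / 3)%:E)%E by near: k; exact: g_cvg.
have Ifg : L1 (f \- g) by exact: L1B.
have Ifgc : L1 (conv (f \- g) (eta k)) by exact: L1c.
have Igc : L1 (g \- conv g (eta k)) by apply: L1B => //; exact: L1c.
have Ifc : L1 (f \- conv f (eta k)) by apply: L1B => //; exact: L1c.
pose h := (f \- g) \- conv (f \- g) (eta k).
have Ih : L1 h by exact: L1B.
apply: (@le_trans _ _ (L1norm h + L1norm (g \- conv g (eta k)))%E).
  apply: L1norm_triangle => // x; rewrite /h /= (convB (eta_mollifier k))//.
  apply: le_trans (ler_normD _ _); rewrite le_eqVlt; apply/orP; left; apply/eqP.
  by congr Num.norm; ring.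
have : (L1norm h <= L1norm (f \- g) + L1norm (conv (f \- g) (eta k)))%E.
  by apply: L1norm_triangle => // x; exact: ler_normB.
have := conv_contracts (eta_mollifier k) Ifg; rewrite -/(L1norm _) -/(L1norm _) => c1 h1.
apply: (@le_trans _ _ ((e / 3)%:E + (e / 3)%:E + (e / 3)%:E)%E).
  apply: leeD gk; apply: (le_trans h1); apply: leeD => //.
  exact: le_trans fge.
by rewrite -!EFinD lee_fin; lra.
Unshelve. all: by end_near. Qed.

(** Where the function is locally constant its mollifications are eventually
    exact, so dominated convergence applies. *)
Lemma approximable_ae_locally_constant f r M :
  measurable_fun (setT : set T) f -> (forall x, `|f x| <= M) ->
  (forall x, r <= `|x| -> f x = 0) ->
  (\forall x \ae lam, exists2 d, 0 < d & forall y, `|x - y| < d -> f y = f x) ->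
  approximable f.
Proof.
move=> mf fM fr fae; have If : L1 f by exact: (integrable_supported mf fM fr).
split=> //; pose D := [set x : V | `|x| < r + 1].
have oD : open D.
  apply: (@open_comp _ _ (fun x : V => `|x|) [set y | y < r + 1]).
    by move=> x _; exact: norm_continuous.
  exact: open_lt.
have Dfin : (lam D < +oo)%E.
  apply: lebesgue_bounded; exists (r + 1); split; first exact: num_real.
  by move=> s rs x Dx; apply: ltW; exact: lt_trans rs.
have IF k : L1 (f \- conv f (eta k)) by apply: L1B => //; exact: L1c.
have [|||||_ _] := @dominated_convergence _ T R lam setT measurableT
  (fun k x => `|(f x - conv f (eta k) x)%:E|)%E (cst 0%E)
  (fun x => ((2 * M) * \1_D x)%:E).
- by move=> k; exact: (measurable_abs_L1 (IF k)).
- exact: measurable_cst.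
- apply: (@filterS _ (almost_everywhere lam) _ _ _ _ fae) => x [d d0 fxd] _; apply/cvge0P => [k|e e0].
    exact: abse_ge0.
  near=> k; rewrite (@conv_locally_constant _ _ _ _ (eta_mollifier k))//.
    by rewrite subrr abse0 lee_fin ltW.
  move=> y xy; apply: fxd; apply: lt_trans xy _; near: k.
  exact: (near_infty_natSinv_lt (PosNum d0)).
- by apply: L1Z; apply: L1_indic => //; exact: measurable_open.
- apply: nearW => x k _; rewrite abse_id lee_fin.
  have M0 : 0 <= M by apply: le_trans (fM 0).
  rewrite indicE; have [xD|xD] := boolP (x \in D).
    rewrite mulr1 (le_trans (ler_normB _ _))// mulr2n mulrDl mul1r lerD//.
    exact: (conv_bounded (eta_mollifier k)).
  rewrite mulr0; have {}xD : r + 1 <= `|x|.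
    by move: xD; rewrite notin_setE /D /= => /negP; rewrite -leNgt.
  rewrite fr ?sub0r ?normrN; last by lra.
  rewrite (conv_eq0 (eta_mollifier k) (r := r))// ?normr0//.
  apply: le_trans xD; rewrite lerD2l invf_le1 ?ler1n ?ltr0n//.
- rewrite integral0 => h e e0.
  by apply: (proj1 (cvge0P _) h) => // k; exact: L1norm_ge0.
Unshelve. all: by end_near. Qed.

End L1Approximation.
Arguments L1norm {R n} f%_ring_scope.

(** * Mollification converges for every integrable function *)

Section L1Density.
Context {R : realType} {n : nat}.
Local Notation V := 'rV[R]_n.
Local Notation T := (lebesgue_type R n).
Local Notation lam := (@lebesgue R n).
Local Notation L1 f := (lam.-integrable setT (EFin \o f)).
Implicit Types (x y : V) (f g : V -> R) (A : set V).

Lemma near_coord x i (U : set R) : nbhs (x 0 i) U -> nbhs x [set y : V | U (y 0 i)].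
Proof. by move=> h; exact: (@coord_continuous R 1 n 0 i x U h). Qed.

(** A point that lies on none of the finitely many hyperplanes carrying the faces
    of a box has a neighbourhood on one side of the boundary of the box. *)
Lemma ae_box_near p : \forall x \ae lam, \forall y \near x, box p y <-> box p x.
Proof.
case: p => [[a b]|]; last by apply: aeW => x; exact: (@nearW _ (nbhs x)).
have off (c : V) : almost_everywhere lam
      [set x : V | forall i, x 0 i <> c 0 i].
  apply: (@filter_forall _ _ (fun i => [set x : V | x 0 i <> c 0 i])
    (almost_everywhere lam)) => i.
  have := negligible_hyperplane i (c 0 i); apply: negligibleS => x /=.
  by move/contrapT.
apply: (@filterS2 _ (almost_everywhere lam) _ _ _ _ _ (off a) (off b)).
move=> x xa xb.
suff : nbhs x [set y : V | forall i,
    (a 0 i < y 0 i <= b 0 i) = (a 0 i < x 0 i <= b 0 i)].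
  apply: (@filterS _ (nbhs x)) => y yx.
  by split=> h i; have := h i; rewrite yx.
apply: (@filter_forall _ _ (fun i => [set y : V |
  (a 0 i < y 0 i <= b 0 i) = (a 0 i < x 0 i <= b 0 i)]) (nbhs x)) => i.
apply: (@near_coord x i (fun t => (a 0 i < t <= b 0 i) = (a 0 i < x 0 i <= b 0 i))).
have [ai|ai|/esym/xa//] := ltgtP (a 0 i) (x 0 i); last first.
  near=> t; rewrite ltNge (_ : t <= a 0 i)//.
  by near: t; exact: (cvgr_le (x 0 i)).
have [bi|bi|/xb//] := ltgtP (x 0 i) (b 0 i).
  near=> t; apply/andP; split.
    by near: t; exact: (cvgr_gt (x 0 i)).
  by near: t; exact: (cvgr_le (x 0 i)).
near=> t; apply/negbTE; rewrite negb_and -!ltNge; apply/orP; right.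
by near: t; exact: (cvgr_gt (x 0 i)).
Unshelve. all: by end_near. Qed.

Lemma box_bounded p : exists2 r : R, 0 <= r & forall x, box p x -> `|x| < r.
Proof.
case: p => [[a b]|]; last by exists 0.
have r0 : 0 < `|a| + `|b| + 1 :> R by rewrite ltr_pwDr// addr_ge0.
exists (`|a| + `|b| + 1); first exact: ltW.
move=> x /= h; rewrite rV_norm_lt//; apply/forallP => i.
have := h i; have := rV_coord_le a i; have := rV_coord_le b i.
rewrite !ler_norml ltr_norml; lra.
Qed.

Variable eta : nat -> V -> R.
Hypothesis eta_mollifier : forall k, is_mollifier k.+1%:R^-1 (eta k).
Local Notation approximable := (approximable eta).

(** Finite unions of boxes are locally constant almost everywhere. *)
Lemma approximable_boxes (F : nat -> option (V * V)) m :
  approximable (\1_(\bigcup_(k in `I_m) box (F k))).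
Proof.
set W := \bigcup_(k in _) _.
have mW : measurable (W : set T).
  by apply: bigcup_measurable => k _; exact: measurable_box.
have [r Fr] : {r : nat -> R & forall k, 0 <= r k /\
    forall x, box (F k) x -> `|x| < r k}.
  apply: (@choice _ _ (fun k s => 0 <= s /\ forall x, box (F k) x -> `|x| < s)).
  by move=> k; have [s] := box_bounded (F k); exists s.
apply: (@approximable_ae_locally_constant _ _ _ eta_mollifier _
  (\sum_(k < m) r k) 1).
- exact: measurable_indic.
- by move=> x; rewrite indicE; case: (_ \in _); rewrite ?normr1 ?normr0.
- move=> x rx; rewrite indicE memNset// => -[k /= km] /(Fr k).2.
  apply/negP; rewrite -leNgt; apply: le_trans rx.
  rewrite (bigD1 (Ordinal km))//= lerDl; apply: sumr_ge0 => j _.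
  exact: (Fr j).1.
- have /ae_foralln : forall k, \forall x \ae lam,
    \forall y \near x, box (F k) y <-> box (F k) x by move=> k; exact: ae_box_near.
  apply: (@filterS _ (almost_everywhere lam)) => x Fx.
  have : nbhs x [set y : V | forall k : 'I_m, box (F k) y <-> box (F k) x].
    by apply: (@filter_forall _ _ (fun (k : 'I_m) =>
      [set y : V | box (F k) y <-> box (F k) x]) (nbhs x)) => k; exact: Fx.
  move=> /nbhs_ballP[d /= d0 dFx]; exists d => // y xy.
  have {}dFx k : (k < m)%N -> box (F k) y <-> box (F k) x.
    move=> km; have : ball x d y by rewrite -ball_normE.
    by move=> /dFx /(_ (Ordinal km)).
  rewrite !indicE (_ : (y \in W) = (x \in W))//.
  by apply/idP/idP; rewrite !inE => -[k /= km] /(dFx k km); exists k.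
Qed.

(** Regularity of the outer measure: finitely many boxes of a good cover miss a
    set of finite measure by a set of small measure. *)
Lemma approximable_indic A : measurable (A : set T) -> (lam A < +oo)%E ->
  approximable (\1_A).
Proof.
move=> mA Afin; apply: approximable_limit => //; first exact: L1_indic.
move=> e e0; have e2 : 0 < e / 2 by rewrite divr_gt0.
have Afn : lam A \is a fin_num by rewrite ge0_fin_numE.
have [_ [F AF <-] Fe] := lb_ereal_inf_adherent e2 Afn.
pose W := \bigcup_k box (F k); pose Wm m := \bigcup_(k in `I_m) box (F k).
have mW : measurable (W : set T).
  by apply: bigcupT_measurable => k; exact: measurable_box.
have mWm m : measurable (Wm m : set T).
  by apply: bigcup_measurable => k _; exact: measurable_box.
have We : (lam W <= lam A + (e / 2)%:E)%E.
  apply: (@le_trans _ _ (\sum_(k <oo) lam (box (F k)))%E).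
    exact: lebesgue_outer_sigma_subadditive.
  apply: le_trans (ltW Fe); apply: lee_nneseries => k _ //.
  exact: lebesgue_box.
have Wfin : (lam W < +oo)%E.
  by apply: le_lt_trans We _; rewrite lte_add_pinfty// ltry.
have mWA : measurable (W `\` A : set T) by exact: measurableD.
have mWW m : measurable (W `\` Wm m : set T) by exact: measurableD.
have WAe : (lam (W `\` A) <= (e / 2)%:E)%E.
  rewrite measureD// (_ : W `&` A = A); last exact/setIidPr.
  by rewrite leeBlDr// addeC.
have WWcvg : lam (W `\` Wm m) @[m --> \oo] --> 0%E.
  rewrite -[X in _ --> X](measure0 lam).
  rewrite (_ : set0 = \bigcap_m (W `\` Wm m)); last first.
    apply/esym/seteqP; split=> // x Wx; have [[k _ Fx] _] := Wx 0%N Logic.I.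
    by have [_] := Wx k.+1 Logic.I; apply; exists k => /=.
  apply: nonincreasing_cvg_mu => //.
  - by apply: le_lt_trans Wfin; apply: le_lebesgue_outer; exact: subDsetl.
  - by apply: bigcapT_measurable => k; exact: mWW.
  - move=> i j ij; apply/subsetPset; apply: setDS => x [k /= ki Fx].
    by exists k => //=; exact: leq_trans ij.
have [m] : exists m, (lam (W `\` Wm m) <= (e / 2)%:E)%E.
  have u0 k : (0 <= lam (W `\` Wm k))%E by exact: measure_ge0.
  have [m _ /(_ m (leqnn m)) h] := proj1 (cvge0P u0) WWcvg _ e2.
  by exists m.
move=> WWe; exists (\1_(Wm m)); first exact: approximable_boxes.
have Wmfin B : B `<=` W -> (lam B < +oo)%E.
  by move=> BW; apply: le_lt_trans Wfin; exact: le_lebesgue_outer.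
have WmW : Wm m `<=` W by move=> x [k _ Fx]; exists k.
apply: (@le_trans _ _ (L1norm (\1_(W `\` A)) + L1norm (\1_(W `\` Wm m)))%E).
  apply: L1norm_triangle.
  - by apply: L1B; apply: L1_indic => //; exact: Wmfin.
  - by apply: L1_indic => //; apply: Wmfin; exact: subDsetl.
  - by apply: L1_indic => //; apply: Wmfin; exact: subDsetl.
  move=> x; rewrite /= !indicE !in_setD.
  have [xA|xA] := boolP (x \in A); have [xWm|xWm] := boolP (x \in Wm m) => /=;
    rewrite ?subrr ?normr0 ?addr_ge0//.
    rewrite (_ : x \in W) ?subr0 ?lerDr//.
    by move: xA; rewrite !inE; exact: AF.
  rewrite (_ : x \in W) ?sub0r ?normrN ?lerDl//.
  by move: xWm; rewrite !inE; exact: WmW.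
rewrite !L1norm_indic//; apply: le_trans (leeD WAe WWe) _.
by rewrite -EFinD lee_fin; lra.
Qed.

Lemma approximable_sum (I : Type) (r : seq I) (F : I -> V -> R) :
  (forall i, approximable (F i)) -> approximable (fun x => \sum_(i <- r) F i x).
Proof.
move=> hF; elim: r => [|i r IH].
  rewrite (_ : (fun x => _) = cst 0); first exact: approximable0.
  by apply/funext => x; rewrite big_nil.
rewrite (_ : (fun x => _) = F i \+ (fun x => \sum_(i <- r) F i x)).
  exact: (approximableD eta_mollifier (hF i) IH).
by apply/funext => x; rewrite big_cons.
Qed.

Import HBSimple.

(** Simple functions are dense in [L^1] and are sums of multiples of indicator
    functions. *)
Lemma approximable_L1 f : L1 f -> approximable f.
Proof.
move=> If; apply: approximable_limit => // e e0.
have [g [Ig _ gf]] := approximation_sfun_integrable measurableT If.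
have [k fgk] : exists k, (L1norm (f \- (g k : T -> R)) <= e%:E)%E.
  have [k _ /(_ k (leqnn k)) h] :=
    proj1 (cvge0P (fun k => L1norm_ge0 (f \- (g k : T -> R)))) gf e e0.
  by exists k.
exists (g k : T -> R) => //; have := Ig k; move: (g k) => {k fgk Ig gf}g Ig.
pose s := finmap.enum_fset (fset_set (range g)).
have -> : (g : T -> R) = (fun x => \sum_(i < size s)
    s`_i * \1_(g @^-1` [set s`_i]) x).
  by apply/funext => x; rewrite {1}fimfunEord.
apply: approximable_sum => i; set c := _`_i.
have [->|c0] := eqVneq c 0.
  rewrite (_ : (fun x => _) = cst 0); first exact: approximable0.
  by apply/funext => x; rewrite mul0r.
have mc : measurable (g @^-1` [set c] : set T).
  by rewrite -[X in measurable X]setTI; exact: measurable_funP.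
apply: approximableZ => //; apply: approximable_indic => //.
rewrite ltNge leye_eq; apply/negP => /eqP oo.
have : (\int[lam]_x (`|c|%:E * (\1_(g @^-1` [set c]) x)%:E) <= L1norm (g : T -> R))%E.
  apply: (ge0_le_integral lam measurableT).
  - by move=> x _; rewrite -EFinM lee_fin mulr_ge0.
  - apply/measurable_funeM/measurable_EFinP; exact: measurable_indic.
  - exact: measurable_abs_L1.
  - move=> x _; rewrite -EFinM lee_fin indicE.
    have [|] := boolP (x \in _); last by rewrite mulr0.
    by rewrite inE /= => ->; rewrite mulr1.
rewrite (ge0_integralZl lam measurableT).
- have -> : (\int[lam]_x (\1_(g @^-1` [set c]) x)%:E = +oo)%E.
    by rewrite integral_indic// setIT; exact: oo.
  rewrite gt0_muley ?lte_fin ?normr_gt0//.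
  by have /integrableP[_] := Ig; rewrite leNgt => ->.
- by apply/measurable_EFinP; exact: measurable_indic.
- by move=> x _; rewrite lee_fin.
- by rewrite lee_fin.
Qed.

End L1Density.

(** * Test functions *)

Section TestFunctions.
Context {R : realType} {n : nat}.
Local Notation V := 'rV[R]_n.
Local Notation T := (lebesgue_type R n).
Local Notation lam := (@lebesgue R n).
Local Notation L1 f := (lam.-integrable setT (EFin \o f)).
Implicit Types (x y : V) (f g h phi psi z : V -> R) (U K S : set V).

Lemma closure_dist S x (e : R) : closure S x -> 0 < e ->
  exists2 y, S y & `|x - y| < e.
Proof.
move=> Sx e0; have [y [Sy]] := Sx _ (nbhsx_ballx x e e0).
by rewrite -ball_normE; exists y.
Qed.

Lemma compact_margin K U : compact K -> open U -> K `<=` U ->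
  exists2 d, 0 < d & forall x y, K x -> `|x - y| < d -> U y.
Proof.
move=> /compact_near_coveringP cK oU KU.
have := cK R (0^'+) (fun e x => forall y, `|x - y| < e -> U y) _.
move=> /(_ _)[|e /= e0 h].
  move=> x Kx; have /nbhs_ballP[e /= e0 eU] : nbhs x U.
    by apply: open_nbhs_nbhs; split=> //; exact: KU.
  have e2 : 0 < e / 2 by rewrite divr_gt0.
  exists (ball x (e / 2), [set d | d < e / 2]).
    by split; [exact: nbhsx_ballx|exact: nbhs_right_lt].
  move=> [x' d] [/= + de] y x'y; rewrite -ball_normE /= => xx'.
  apply: eU; rewrite -ball_normE /=.
  by have := ler_distD x' x y; lra.
exists (e / 2); first by rewrite divr_gt0.
move=> x y Kx; apply: (h (e / 2)) => //; rewrite /ball /=.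
  by rewrite sub0r normrN gtr0_norm ?divr_gt0//; lra.
by rewrite divr_gt0.
Qed.

(** The margin [r] absorbs the closure in the definition of the support. *)
Lemma test_function_within U phi S (r : R) : 0 < r -> smooth phi ->
  bounded_set S -> (forall x, phi x != 0 -> S x) ->
  (forall x y, S x -> `|x - y| < r -> U y) -> test_function U phi.
Proof.
move=> r0 sphi [M [_ SM]] phiS SU; have sub x : closure [set x | phi x != 0] x ->
    forall e, 0 < e -> exists2 y, S y & `|x - y| < e.
  by move=> cx e /(closure_dist cx)[y /phiS Sy xy]; exists y.
split=> //.
- apply: bounded_closed_compact; last exact: closed_closure.
  exists (M + 2); split; first exact: num_real.
  move=> s Ms x /sub /(_ 1 ltr01)[y Sy xy].
  have := SM (M + 1) _ y Sy; rewrite ltrDl ltr01 => /(_ isT) /= yM.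
  by have := ler_normD (x - y) y; rewrite subrK; lra.
- by move=> x /sub /(_ _ r0)[y Sy xy]; apply: (SU y x Sy); rewrite distrC.
Qed.

Lemma test_function_supported U phi : test_function U phi ->
  bounded_support phi.
Proof.
move=> [_ /compact_bounded[M [_ hM]] _]; exists (M + 2) => x Mx; apply/eqP.
apply: contraT => phix; have : `|x| <= M + 1.
  by apply: (hM (M + 1)); [rewrite ltrDl|exact: subset_closure].
by move=> h; have := le_trans Mx h; rewrite lerD2l => ?; lra.
Qed.

Lemma test_function_out U phi x : test_function U phi -> ~ U x -> phi x = 0.
Proof.
move=> [_ _ phiU] Ux; apply/eqP; apply: contrapT => /negP phix; apply: Ux.
by apply: phiU; exact: subset_closure.
Qed.

Lemma test_functionS U1 U2 phi : U1 `<=` U2 -> test_function U1 phi ->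
  test_function U2 phi.
Proof. by move=> U12 [s c phiU]; split=> //; exact: subset_trans U12. Qed.

Lemma test_functionM U phi f : test_function U phi -> smooth f ->
  test_function U (phi \* f).
Proof.
move=> [s c phiU] sf.
have sub : closure [set x | (phi \* f) x != 0] `<=` closure [set x | phi x != 0].
  apply: closure_subset => x /=; apply: contra_neq => ->; exact: mul0r.
split; first exact: smoothM.
- by apply: (subclosed_compact _ c sub); exact: closed_closure.
- exact: subset_trans phiU.
Qed.

(** Derivatives are local, so they vanish where the function is constant. *)
Lemma pderiv_near f x (c : R) al : (\forall y \near x, f y = c) ->
  \forall y \near x, pderiv f al y = if al is [::] then c else 0.
Proof.
move=> fc; elim: al => [//|i al IH].
have := @near_join _ _ _ IH; apply: (@filterS _ (nbhs x)) => y hy /=.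
have {}hy : \forall t \near y, pderiv f al t = cst (pderiv f al y) t.
  by have := nbhs_singleton hy; move=> /= E; apply: (@filterS _ (nbhs y)) hy => t ->.
by rewrite (near_eq_derive _ hy) derive_cst.
Qed.

Lemma pderiv_out f al x : ~ closure [set x | f x != 0] x -> pderiv f al x = 0.
Proof.
move=> fx; have : \forall y \near x, f y = 0.
  have : nbhs x (~` closure [set x | f x != 0]).
    by apply: open_nbhs_nbhs; split=> //; exact/closed_openC/closed_closure.
  apply: (@filterS _ (nbhs x)) => y fy; apply/eqP; apply: contrapT => /negP fy0.
  by apply: fy; exact: subset_closure.
by move=> /(pderiv_near al) /nbhs_singleton ->; case: al.
Qed.

Lemma test_function_pderiv U phi al : test_function U phi ->
  test_function U (pderiv phi al).
Proof.
move=> [s c phiU].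
have sub : closure [set x | pderiv phi al x != 0] `<=` closure [set x | phi x != 0].
  set C := closure [set x | phi x != 0].
  have sub : [set x | pderiv phi al x != 0] `<=` C.
    move=> x /= phix; apply: contrapT => /(pderiv_out al) phi0.
    by rewrite phi0 eqxx in phix.
  apply: subset_trans (closure_subset sub) _.
  by rewrite -(proj1 (closure_id C))//; exact: closed_closure.
split; first exact: smooth_pderiv.
- by apply: (subclosed_compact _ c sub); exact: closed_closure.
- exact: subset_trans phiU.
Qed.

End TestFunctions.

(** * Uniqueness of weak derivatives *)

Section WeakDerivativeUniqueness.
Context {R : realType} {n : nat}.
Local Notation V := 'rV[R]_n.
Local Notation T := (lebesgue_type R n).
Local Notation lam := (@lebesgue R n).
Local Notation L1 f := (lam.-integrable setT (EFin \o f)).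
Implicit Types (x y : V) (f g h phi psi z : V -> R) (U K S : set V).
Implicit Types (al : seq 'I_n).

(** Lindelof: a property that holds almost everywhere near each point of a set
    holds almost everywhere on the set. *)
Lemma ae_local U (P : set V) :
  (forall x, U x -> exists2 d : R, 0 < d &
     almost_everywhere lam [set y | `|x - y| < d -> P y]) ->
  almost_everywhere lam [set y | U y -> P y].
Proof.
move=> HU; pose F k : set V := if @unpickle ('rV[rat]_n * 'rV[rat]_n)%type k is Some q
  then if `[< almost_everywhere lam [set y | rbox q y -> P y] >]
       then ~` [set y | rbox q y -> P y] else set0
  else set0.
apply: (@negligibleS _ _ _ lam (\bigcup_k F k)); last first.
  apply: negligible_bigcup => k; rewrite /F.
  case: unpickle => [q|]; last exact: negligible_set0.
  by case: ifPn => [/asboolP//|_]; exact: negligible_set0.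
move=> y /= /not_implyP[Uy Py]; have [d d0 hd] := HU y Uy.
have [q [qy qd]] := rbox_nbhs y d0; exists (pickle q) => //.
rewrite /F pickleK; case: ifPn => [_|/asboolP ne].
  by move=> /(_ qy).
exfalso; apply: ne; apply: filterS hd => t /= ht qt; apply: ht.
by have := qd t qt; rewrite -ball_normE.
Qed.

(** Test functions vanish off their open set, so all the weak formulations can be
    compared on the whole space. *)
Lemma integral_test U g phi : test_function U phi ->
  (\int[lam]_(x in U) (g x * phi x)%:E = \int[lam]_x (g x * phi x)%:E)%E.
Proof.
move=> tphi; rewrite integral_mkcond; apply: eq_integral => x _.
rewrite patchE; case: ifPn => //; rewrite notin_setE => Ux.
by rewrite (test_function_out tphi Ux) mulr0.
Qed.

Lemma loc_integrable_test U g phi : loc_integrable U g -> test_function U phi ->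
  L1 (fun x => g x * phi x).
Proof.
move=> gU tphi; have [sphi cK KU] := tphi; set K := closure _ in cK KU.
have mK : measurable (K : set T) by exact: measurable_compact.
have gK := gU _ cK KU; have cphi := smooth_continuous sphi.
have [r phir] := test_function_supported tphi.
have [M _ phiM] := bounded_supported cphi phir.
have : lam.-integrable K (fun x => (g x)%:E * (phi x)%:E)%E.
  apply: (@integrableMl _ T R lam K mK (EFin \o g) phi gK).
    exact/measurable_funTS/measurable_continuous.
  exists M; split; first exact: num_real.
  by move=> s Ms y _; apply: (le_trans (phiM _)); exact: ltW.
move/(integrable_mkcond (mu := lam) _ mK).
rewrite (_ : _ \_ K = EFin \o (fun x => g x * phi x))//.
apply/funext => x; rewrite patchE; case: ifPn => [//|]; rewrite notin_setE => Kx.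
rewrite /=; suff -> : phi x = 0 by rewrite mulr0.
apply/eqP; apply: contrapT => /negP phix; apply: Kx; exact: subset_closure.
Qed.

Lemma mollifier_sequence : ~ lam.-negligible [set: V] ->
  exists eta : nat -> V -> R, forall k, is_mollifier k.+1%:R^-1 (eta k).
Proof.
move=> nT; have /choice[eta etaP] : forall k : nat,
  exists eta : V -> R, is_mollifier k.+1%:R^-1 eta.
  by move=> k; apply: mollifier_exists => //; rewrite invr_gt0.
by exists eta.
Qed.

(** A bump around a point times [g] has vanishing mollifications, which converge
    to it. *)
Lemma weakly_zero U g : ~ lam.-negligible [set: V] -> open U ->
  loc_integrable U g ->
  (forall phi, test_function U phi -> (\int[lam]_x (g x * phi x)%:E = 0)%E) ->
  almost_everywhere lam [set x | U x -> g x = 0].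
Proof.
move=> nT oU gU g0; have [eta etaP] := mollifier_sequence nT.
apply: ae_local => x Ux; have /nbhs_ballP[e /= e0 eU] : nbhs x U.
  exact: open_nbhs_nbhs.
pose d := e / 2; have d0 : 0 < d by rewrite divr_gt0.
exists d => //; pose z y := bump d (x - y).
have sz : smooth z by exact/smooth_reflect/smooth_bump.
have zx y : z y != 0 -> `|x - y| < d.
  move=> zy; rewrite ltNge; apply: contra zy => dxy.
  by apply/eqP; exact: bump_eq0.
have tz : test_function U z.
  apply: (@test_function_within _ _ _ _ [set y | `|x - y| < d] d) => //.
    exists (`|x| + d); split; first exact: num_real.
    move=> s xs y /= xy; have := ler_normD (y - x) x; rewrite subrK distrC; lra.
  move=> y t /= xy yt; apply: eU; rewrite -ball_normE /=.
  by have := ler_distD y x t; rewrite /d in xy yt; lra.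
pose h y := g y * z y; have Ih : L1 h by exact: loc_integrable_test tz.
have ch k y : conv h (eta k) y = 0.
  have [seta _ _ _ _] := etaP k.
  have tze : test_function U (z \* (fun t => eta k (y - t))).
    exact: (test_functionM tz (smooth_reflect y seta)).
  rewrite /conv /Rintegral -[RHS]/(fine 0%E) -(g0 _ tze); congr fine.
  by apply: eq_integral => t _; rewrite /h /= mulrA.
have Nh : L1norm h = 0%E.
  apply/eqP; rewrite eq_le L1norm_ge0 andbT; apply/lee_addgt0Pr => r r0.
  rewrite add0e; have [_ /(_ r r0)[k _ /(_ k (leqnn k))]] := approximable_L1 etaP Ih.
  rewrite (_ : h \- conv h (eta k) = h)//.
  by apply/funext => y /=; rewrite ch subr0.
have := @ae_eq_integral_abs _ T R lam setT measurableT _ (measurable_int _ Ih).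
move=> [/(_ Nh) + _]; apply: filterS => y /= /(_ Logic.I) [] hy xy.
move/eqP : hy; rewrite /h mulf_eq0 => /orP[/eqP//|].
by rewrite gt_eqF// /z bump_gt0.
Qed.

Lemma is_weak_deriv_unique U f al g1 g2 : ~ lam.-negligible [set: V] -> open U ->
  is_weak_deriv U f al g1 -> is_weak_deriv U f al g2 ->
  almost_everywhere lam [set x | U x -> g1 x = g2 x].
Proof.
move=> nT oU [_ g1U H1] [_ g2U H2].
have gU : loc_integrable U (g1 \- g2).
  move=> K cK KU.
  by have := integrableB (measurable_compact cK) (g1U _ cK KU) (g2U _ cK KU).
have := weakly_zero nT oU gU; move=> /(_ _) h; apply: filterS (h _).
  by move=> x /= + Ux => /(_ Ux) /eqP; rewrite subr_eq0 => /eqP.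
move=> phi tphi; have I1 := loc_integrable_test g1U tphi.
have I2 := loc_integrable_test g2U tphi.
have := H1 _ tphi; rewrite (H2 _ tphi) !(integral_test _ tphi) => E.
under eq_integral do rewrite /= mulrBl EFinB.
rewrite (integralB measurableT I1 I2).
have F1 := integrable_fin_num measurableT I1.
have F2 := integrable_fin_num measurableT I2.
move: E; rewrite /comp; rewrite -(fineK F1) -(fineK F2) -!EFinM -EFinB => -[].
have sgn0 : (-1) ^+ size al != 0 :> R by rewrite signr_eq0.
by move=> /(mulfI sgn0) ->; rewrite subrr.
Qed.

Lemma weak_derivP U f al g : is_weak_deriv U f al g ->
  is_weak_deriv U f al (weak_deriv U f al).
Proof. by move=> fg; apply: (xgetPex (cst 0)); exists g. Qed.

End WeakDerivativeUniqueness.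

(** * Cutoff functions and the product rule *)

Section CutoffAndLeibniz.
Context {R : realType} {n : nat}.
Local Notation V := 'rV[R]_n.
Local Notation T := (lebesgue_type R n).
Local Notation lam := (@lebesgue R n).
Local Notation L1 f := (lam.-integrable setT (EFin \o f)).
Implicit Types (x y : V) (f h phi psi z : V -> R) (U K S : set V).
Implicit Types (al be ga : seq 'I_n).

(** The cutoff is a mollified indicator function of a neighbourhood of [K]. *)
Lemma cutoff_exists K U : ~ lam.-negligible [set: V] -> compact K -> open U ->
  K `<=` U -> exists z, test_function U z /\ exists2 d, 0 < d &
    forall x y, K x -> `|x - y| < d -> \forall t \near y, z t = 1.
Proof.
move=> nT cK oU KU; have [r r0 hr] := compact_margin cK oU KU.
pose d := r / 4; have d0 : 0 < d by rewrite divr_gt0.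
have [eta etaP] := mollifier_exists d0 nT.
have [seta _ etad _ _] := etaP.
pose N c := [set y : V | exists2 x, K x & `|x - y| < c].
have oN c : open (N c).
  rewrite openE => y [x Kx xy]; apply/nbhs_ballP.
  exists (c - `|x - y|); first by rewrite /= subr_gt0.
  move=> t; rewrite -ball_normE /= => yt; exists x => //.
  by have := ler_distD y x t; lra.
have [B [_ KB]] := compact_bounded cK.
have bN c : bounded_set (N c).
  exists (B + 1 + c); split; first exact: num_real.
  move=> s Bs y [x Kx xy]; have := KB (B + 1) _ x Kx; rewrite ltrDl ltr01.
  move=> /(_ isT) /= xB.
  by have := ler_normD (y - x) x; rewrite subrK distrC; lra.
have IN : L1 (\1_(N (2 * d))).
  by apply: L1_indic; [exact: measurable_open|exact: lebesgue_bounded].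
pose z := conv (\1_(N (2 * d))) eta.
have sz : smooth z by apply: smooth_conv => //; exists d.
exists z; split.
  apply: (@test_function_within _ _ _ _ (N (3 * d)) d) => //.
    move=> t; apply: contraPP => Nt /eqP; apply.
    rewrite -[RHS](_ : (\int[lam]_(y in setT) (cst 0 y))%R = 0); last first.
      by rewrite /Rintegral integral0.
    apply: eq_Rintegral => y _; rewrite /= indicE.
    have [|] := boolP (y \in _); last by rewrite mul0r.
    rewrite inE => -[x Kx xy]; rewrite mul1r etad// leNgt; apply/negP => ty.
    apply: Nt; exists x => //; have := ler_distD y x t; rewrite (distrC y t); lra.
  move=> x y [t Kt tx] xy; apply: (hr t) => //.
  by have := ler_distD x t y; rewrite /d in tx xy; lra.
exists (d / 2); first by rewrite divr_gt0.
have d2 : 0 < d / 2 by rewrite divr_gt0.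
move=> x y Kx xy; apply: (@filterS _ (nbhs y) _ _ _ _ (near_dist_lt y d2)) => t yt.
have xt : `|x - t| < d by have := ler_distD y x t; lra.
have Nt s : `|x - s| < 2 * d -> \1_(N (2 * d)) s = 1 :> R.
  by move=> xs; rewrite indicE mem_set//; exists x.
rewrite /z (conv_locally_constant etaP IN); first by apply: Nt; lra.
by move=> s ts; rewrite !Nt//; [lra|have := ler_distD t x s; lra].
Qed.

(** The order-by-order product rule for [z * g []], where [g be] stands for the
    weak derivative of [g [::]] along [be]: each step either differentiates [g]
    or the cutoff [z]. *)
Fixpoint leibniz (g : seq 'I_n -> V -> R) al z be : V -> R :=
  if al is i :: al' then
    leibniz g al' z (rcons be i) \+ leibniz g al' (pderiv z [:: i]) be
  else z \* g be.

Lemma leibniz_out g al z be x : (forall ga, pderiv z ga x = 0) ->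
  leibniz g al z be x = 0.
Proof.
elim: al z be => [|i al IH] z be zx /=; first by rewrite (zx [::] : z x = 0) mul0r.
rewrite !IH ?addr0// => ga.
by have := zx (rcons ga i); rewrite pderiv_rcons.
Qed.

(** Where the cutoff is locally 1, only the term that never differentiates it
    survives. *)
Lemma leibniz_in g al z be x : (forall ga, pderiv z ga x = (ga == [::])%:R) ->
  leibniz g al z be x = g (be ++ al) x.
Proof.
elim: al z be => [|i al IH] z be zx /=; first by rewrite (zx [::] : z x = 1) mul1r cats0.
rewrite IH// cat_rcons leibniz_out ?addr0// => ga.
by have := zx (rcons ga i); rewrite pderiv_rcons => ->; case: ga.
Qed.

Section Leibniz.
Variables (Om : set V) (k : nat) (g : seq 'I_n -> V -> R) (f : V -> R).
Hypothesis mg : forall be, (size be <= k)%N -> measurable_fun (setT : set T) (g be).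
Hypothesis bg : forall be, (size be <= k)%N -> exists M, forall x, `|g be x| <= M.
Hypothesis gW : forall be psi, (size be <= k)%N -> test_function Om psi ->
  (\int[lam]_x (f x * pderiv psi be x))%R =
    (-1) ^+ size be * (\int[lam]_x (g be x * psi x))%R.

Lemma leibniz_measurable al z be : test_function Om z ->
  (size be + size al <= k)%N -> measurable_fun (setT : set T) (leibniz g al z be).
Proof.
elim: al z be => [|i al IH] z be tz /= sz.
  apply: measurable_funM; last by apply: mg; rewrite addn0 in sz.
  by apply: measurable_continuous; apply: smooth_continuous; case: tz.
apply: measurable_funD; apply: IH => //; rewrite ?size_rcons.
- by rewrite addSnnS.
- exact: (test_function_pderiv [:: i] tz).
- by apply: leq_trans sz; rewrite leq_add2l.
Qed.

Lemma leibniz_bounded al z be : test_function Om z ->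
  (size be + size al <= k)%N -> exists M, forall x, `|leibniz g al z be x| <= M.
Proof.
elim: al z be => [|i al IH] z be tz /= sz.
  have [|M gM] := @bg be; first by rewrite addn0 in sz.
  have [r zr] := test_function_supported tz.
  have cz : continuous z by apply: smooth_continuous; case: tz.
  have [B _ zB] := bounded_supported cz zr; exists (B * M) => x.
  by rewrite normrM ler_pM.
have [|M1 h1] := IH z (rcons be i) tz; first by rewrite size_rcons addSnnS.
have [|M2 h2] := IH _ be (test_function_pderiv [:: i] tz).
  by apply: leq_trans sz; rewrite leq_add2l.
by exists (M1 + M2) => x; rewrite (le_trans (ler_normD _ _))// lerD.
Qed.

Lemma leibniz_supp al z be x : ~ closure [set x | z x != 0] x ->
  leibniz g al z be x = 0.
Proof. by move=> zx; apply: leibniz_out => ga; exact: pderiv_out. Qed.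

Lemma L1_leibniz al z be : test_function Om z -> (size be + size al <= k)%N ->
  L1 (leibniz g al z be).
Proof.
move=> tz sz; have [M hM] := leibniz_bounded tz sz.
have [r zr] : exists r, forall x, r <= `|x| -> leibniz g al z be x = 0.
  have [_ /compact_bounded[B [_ hB]] _] := tz; exists (B + 2) => x xr.
  apply: leibniz_supp => zx; have := hB (B + 1) _ x zx.
  by rewrite ltrDl ltr01 => /(_ isT) /=; lra.
by apply: (integrable_supported _ hM zr); exact: leibniz_measurable.
Qed.

Lemma L1_leibnizM al z be phi : test_function Om z -> smooth phi ->
  (size be + size al <= k)%N -> L1 (fun x => leibniz g al z be x * phi x).
Proof.
move=> tz sphi sz; have [_ cK _] := tz.
have cphi := smooth_continuous sphi.
have [B1 h1] := leibniz_bounded tz sz.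
have [B2 [_ h2]] := compact_bounded (continuous_compact (continuous_subspaceT cphi) cK).
have [B [_ hB]] := compact_bounded cK.
have out x : ~ closure [set x | z x != 0] x -> leibniz g al z be x * phi x = 0.
  by move=> zx; rewrite leibniz_supp// mul0r.
apply: (@integrable_supported _ _ _ (B + 2) (B1 * (`|B2| + 1))).
- apply: measurable_funM; first exact: leibniz_measurable.
  exact: measurable_continuous.
- move=> x; have [zx|zx] := pselect (closure [set x | z x != 0] x).
    rewrite normrM ler_pM//; apply: (h2 (`|B2| + 1)); last by exists x.
    by rewrite ltr_pwDr// ler_norm.
  rewrite out// normr0 mulr_ge0//.
  by apply: le_trans (h1 0).
- move=> x xr; apply: out => zx; have := hB (B + 1) _ x zx.
  by rewrite ltrDl ltr01 => /(_ isT) /=; lra.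
Qed.

Lemma L1_weak_test be psi : (size be <= k)%N -> test_function Om psi ->
  L1 (fun x => g be x * psi x).
Proof.
move=> sbe tpsi; have := @L1_leibnizM [::] psi be (cst 1) tpsi (smooth_cst 1).
rewrite addn0 => /(_ sbe); rewrite (_ : (fun x => _ * cst 1 x) = (fun x => g be x * psi x))//.
by apply/funext => x /=; rewrite mulr1 mulrC.
Qed.

(** The family [g] is defined by derivatives of [f]; comparing the orders [be] and
    [rcons be i] makes [g (rcons be i)] the weak derivative of [g be]. *)
Lemma weak_step be i psi : (size be < k)%N -> test_function Om psi ->
  (\int[lam]_x (g be x * pderiv psi [:: i] x))%R =
    - (\int[lam]_x (g (rcons be i) x * psi x))%R.
Proof.
move=> sbe tpsi; have := gW (ltnW sbe) (test_function_pderiv [:: i] tpsi).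
rewrite -pderiv_rcons gW// ?size_rcons// exprS mulN1r mulNr.
have sgn0 : (-1) ^+ size be != 0 :> R by rewrite signr_eq0.
by rewrite -mulrN => /(mulfI sgn0).
Qed.

(** Weak differentiation of [z * g be], one order at a time: with
    [psi = D^al phi], the identity [z * D_i psi = D_i (z * psi) - D_i z * psi] trades
    the outermost derivative of [phi] for the two terms of the recursion. Any smooth
    [phi] is allowed because [z] carries the compact support, and so the lemma
    applies to reflected mollifiers. *)
Lemma leibniz_weak al z be phi : test_function Om z -> smooth phi ->
  (size be + size al <= k)%N ->
  (\int[lam]_x (z x * g be x * pderiv phi al x))%R =
    (-1) ^+ size al * (\int[lam]_x (leibniz g al z be x * phi x))%R.
Proof.
move=> + sphi; elim: al z be => [|i al IH] z be tz sz.
  by rewrite expr0 mul1r.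
pose psi := pderiv phi al; have spsi : smooth psi by exact: smooth_pderiv.
have sz1 : (size (rcons be i) + size al <= k)%N by rewrite size_rcons addSnnS.
have sz2 : (size be + size al <= k)%N.
  by apply: leq_trans sz; rewrite leq_add2l.
have tzi := test_function_pderiv [:: i] tz.
have tzpsi : test_function Om (z \* psi) by exact: test_functionM.
have sbe : (size be < k)%N.
  by apply: leq_trans sz; rewrite /= addnS ltnS leq_addr.
have I1 := L1_weak_test (ltnW sbe) (test_function_pderiv [:: i] tzpsi).
have I2 := L1_weak_test (ltnW sbe) (test_functionM tzi spsi).
transitivity (\int[lam]_x (g be x * pderiv (z \* psi) [:: i] x -
    g be x * (pderiv z [:: i] \* psi) x))%R.
  apply: eq_Rintegral => x _; rewrite (pderiv1M i x _ spsi); last by case: tz.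
  by rewrite /psi -(pderiv_cat phi [:: i]) /=; ring.
rewrite RintegralB// weak_step//.
transitivity (- ((\int[lam]_x (z x * g (rcons be i) x * pderiv phi al x))%R +
    (\int[lam]_x (pderiv z [:: i] x * g be x * pderiv phi al x))%R)).
  rewrite opprD; congr (- _ - _); apply: eq_Rintegral => x _; rewrite /psi /=; ring.
rewrite IH// IH// -mulrDr exprS mulN1r mulNr; congr (- (_ * _)).
rewrite -RintegralD//; try exact: L1_leibnizM.
by apply: eq_Rintegral => x _; rewrite /= mulrDl.
Qed.

End Leibniz.
End CutoffAndLeibniz.

(** * Bounded representatives and norms *)

Section SobolevVariation.
Context {R : realType} {n : nat}.
Local Notation V := 'rV[R]_n.
Local Notation T := (lebesgue_type R n).
Local Notation lam := (@lebesgue R n).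
Local Notation L1 f := (lam.-integrable setT (EFin \o f)).
Implicit Types (x y : V) (f h phi psi z : V -> R) (U K S : set V).
Implicit Types (al be ga : seq 'I_n).

Hypothesis nonnull : ~ lam.-negligible [set: V].

Lemma lebesgue_setT_gt0 : (0 < lam setT)%E.
Proof.
rewrite lt0e measure_ge0 andbT; apply/eqP => T0; apply: nonnull.
by apply/negligibleP => //; exact: measurableT.
Qed.

Lemma loc_integrable_bounded U h M : measurable_fun (setT : set T) h ->
  (forall x, `|h x| <= M) -> loc_integrable U h.
Proof.
move=> mh hM K cK _; apply: (@integrable_bounded _ _ _ _ M) => //.
- exact: measurable_compact.
- exact: compact_bounded.
- exact: measurable_funTS.
Qed.

Lemma loc_integrableM U f h M : loc_integrable U f ->
  measurable_fun (setT : set T) h -> (forall x, `|h x| <= M) ->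
  loc_integrable U (fun x => h x * f x).
Proof.
move=> fU mh hM K cK KU; have fK := fU _ cK KU.
have := @integrableMr _ T R lam K (measurable_compact cK) h (EFin \o f).
apply=> //; first exact: measurable_funTS.
exists M; split; first exact: num_real.
by move=> s Ms y _; apply: (le_trans (hM _)); exact: ltW.
Qed.

Lemma loc_integrableD U f h : loc_integrable U f -> loc_integrable U h ->
  loc_integrable U (f \+ h).
Proof.
move=> fU hU K cK KU.
by have := integrableD (measurable_compact cK) (fU _ cK KU) (hU _ cK KU).
Qed.

Lemma is_weak_deriv_ae U f al g h M : is_weak_deriv U f al g ->
  measurable_fun (setT : set T) h -> (forall x, `|h x| <= M) ->
  almost_everywhere lam [set x | U x -> g x = h x] -> is_weak_deriv U f al h.
Proof.
move=> [fU gU gW] mh hM gh; have hU := loc_integrable_bounded (U := U) mh hM.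
split=> // phi tphi; rewrite gW//; congr (_ * _)%E.
rewrite !(integral_test _ tphi); apply: ae_eq_integral; first exact: measurableT.
- exact: measurable_int (loc_integrable_test gU tphi).
- exact: measurable_int (loc_integrable_test hU tphi).
- apply: filterS gh => x /= gh _; have [/gh ->//|Ux] := pselect (U x).
  by rewrite (test_function_out tphi Ux) !mulr0.
Qed.

Lemma Lp_oo_ae_bounded U h : Lp +oo%E U h ->
  exists M, almost_everywhere lam [set x | U x -> `|h x| <= M].
Proof.
move=> [_]; rewrite /Lp_norm unlock lebesgue_setT_gt0 => hoo.
have [M hM] := ess_supr_bounded (f := fun x : T => `|(h \_ U) x|) hoo.
exists M; apply: filterS hM => x /= + Ux.
by rewrite patchE mem_set.
Qed.

(** Truncation at an essential bound, and extension by zero, change the weak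
    derivative on a null set and make it bounded and measurable everywhere. *)
Lemma bounded_representative U f al g : open U -> is_weak_deriv U f al g ->
  Lp +oo%E U g -> exists h, [/\ is_weak_deriv U f al h,
    measurable_fun (setT : set T) h & exists M, forall x, `|h x| <= M].
Proof.
move=> oU gW gLp; have [M gM] := Lp_oo_ae_bounded gLp.
have mG : measurable_fun (setT : set T) (g \_ U).
  by apply/(measurable_restrictT _ (measurable_open oU)).1; case: gLp.
pose h x := if `|(g \_ U) x| <= M then (g \_ U) x else 0.
have mh : measurable_fun (setT : set T) h.
  apply: measurable_fun_ifT; [|exact: mG|exact: measurable_cst].
  apply: measurable_fun_ler; last exact: measurable_cst.
  by apply: measurableT_comp mG; exact: normr_measurable.
have hM x : `|h x| <= `|M|.
  rewrite /h; case: ifP => [h1|_]; last by rewrite normr0.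
  exact: le_trans h1 (ler_norm _).
exists h; split=> //; last by exists `|M|.
apply: (is_weak_deriv_ae gW mh hM); apply: filterS gM => x /= gM Ux.
by rewrite /h patchE mem_set// gM.
Qed.

Lemma bounded_Lp_oo U h M : measurable_fun (setT : set T) h ->
  (forall x, `|h x| <= M) -> Lp +oo%E U h.
Proof.
move=> mh hM; split; first exact: measurable_funTS.
rewrite /Lp_norm unlock lebesgue_setT_gt0.
apply: (@le_lt_trans _ _ M%:E); last exact: ltry.
apply/ess_supP; apply: aeW => x /=; rewrite lee_fin patchE; case: ifP => // _.
by rewrite normr0; apply: le_trans (hM 0).
Qed.

Lemma Lp_norm1_restrict U h : open U -> L1 h -> (Lp_norm 1%:E U h <= L1norm h)%E.
Proof.
move=> oU Ih; rewrite /Lp_norm Lnorm1; apply: (ge0_le_integral lam measurableT).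
- by move=> x _; exact: abse_ge0.
- apply: measurableT_comp; first exact: abse_measurable.
  apply/measurable_EFinP/(measurable_restrictT _ (measurable_open oU)).1.
  by apply: measurable_funTS; exact: measurable_L1.
- exact: measurable_abs_L1.
- move=> x _ /=; rewrite lee_fin patchE; case: ifP => // _.
  by rewrite normr0.
Qed.

(** Completeness of the Lebesgue measure: the norm only depends on the class of
    the function modulo null sets, with no measurability to check. *)
Lemma Lp_norm1_ae U h1 h2 : open U -> L1 h1 ->
  almost_everywhere lam [set x | U x -> h1 x = h2 x] ->
  Lp_norm 1%:E U h1 = Lp_norm 1%:E U h2.
Proof.
move=> oU I1 h12; rewrite /Lp_norm !Lnorm1.
have m1 : measurable_fun (setT : set T) (EFin \o (h1 \_ U)).
  apply/measurable_EFinP/(measurable_restrictT _ (measurable_open oU)).1.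
  by apply: measurable_funTS; exact: measurable_L1.
have e12 : ae_eq lam setT (EFin \o (h1 \_ U)) (EFin \o (h2 \_ U)).
  apply: filterS h12 => x /= h12 _; rewrite !patchE; case: ifPn => //.
  by rewrite inE => /h12 ->.
have m2 : measurable_fun (setT : set T) (EFin \o (h2 \_ U)).
  by apply: ae_measurable_fun e12 m1; exact: measure_is_complete_caratheodory.
apply: ae_eq_integral; first exact: measurableT.
- by apply: measurableT_comp m1; exact: abse_measurable.
- by apply: measurableT_comp m2; exact: abse_measurable.
- by apply: filterS e12 => x h /h ->.
Qed.

End SobolevVariation.

(** * The variation by a cutoff *)

Section CutoffVariation.
Context {R : realType} {n : nat}.
Local Notation V := 'rV[R]_n.
Local Notation T := (lebesgue_type R n).
Local Notation lam := (@lebesgue R n).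
Local Notation L1 f := (lam.-integrable setT (EFin \o f)).
Implicit Types (x y : V) (phi psi : V -> R) (al be : seq 'I_n).

Hypothesis nonnull : ~ lam.-negligible [set: V].

Variables (Om U : set V) (f : V -> R) (k : nat) (g : seq 'I_n -> V -> R).
Variables (z : V -> R) (c : R).
Hypothesis oU : open U.
Hypothesis UOm : U `<=` Om.
Hypothesis tz : test_function U z.
Hypothesis gf : forall al, (size al <= k)%N -> [/\ is_weak_deriv Om f al (g al),
  measurable_fun (setT : set T) (g al) & exists M, forall x, `|g al x| <= M].

Let mg al : (size al <= k)%N -> measurable_fun (setT : set T) (g al).
Proof. by case/gf. Qed.

Let bg al : (size al <= k)%N -> exists M, forall x, `|g al x| <= M.
Proof. by case/gf. Qed.

Let tzOm : test_function Om z. Proof. exact: test_functionS tz. Qed.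

Let gW al psi : (size al <= k)%N -> test_function Om psi ->
  (\int[lam]_x (f x * pderiv psi al x))%R =
    (-1) ^+ size al * (\int[lam]_x (g al x * psi x))%R.
Proof.
move=> /gf[[fOm gOm w] _ _] tpsi; have := w _ tpsi.
rewrite (integral_test _ tpsi) (integral_test _ (test_function_pderiv al tpsi)).
rewrite /Rintegral => ->; rewrite fineM//.
by apply: integrable_fin_num => //; exact: loc_integrable_test gOm tpsi.
Qed.

(** The weak derivatives of [c * (z * f)]. *)
Definition variation_deriv al x := c * leibniz g al z [::] x.

Lemma L1_variation_deriv al : (size al <= k)%N -> L1 (variation_deriv al).
Proof. by move=> sal; apply: L1Z; apply: (L1_leibniz mg bg tzOm). Qed.

Lemma measurable_variation_deriv al : (size al <= k)%N ->
  measurable_fun (setT : set T) (variation_deriv al).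
Proof. by move=> /L1_variation_deriv; exact: measurable_L1. Qed.

Lemma variation_deriv_bounded al : (size al <= k)%N ->
  exists M, forall x, `|variation_deriv al x| <= M.
Proof.
move=> sal; have [M hM] := leibniz_bounded bg tzOm (be := [::]) sal.
exists (`|c| * M) => x; rewrite normrM ler_wpM2l//; exact: hM.
Qed.

Lemma variation_weak_deriv al : (size al <= k)%N ->
  is_weak_deriv U (fun x => c * (z x * f x)) al (variation_deriv al).
Proof.
move=> sal; have [M hM] := variation_deriv_bounded sal.
have fOm : loc_integrable Om f by have [[]] := @gf [::] isT.
have fU : loc_integrable U f by move=> K cK KU; apply: fOm => // x /KU /UOm.
have cz : continuous z by apply: smooth_continuous; case: tz.
have [r zr] := test_function_supported tz.
have [B _ zB] := bounded_supported cz zr.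
split.
- rewrite (_ : (fun x => _) = (fun x => (c * z x) * f x)); last first.
    by apply/funext => x; rewrite mulrA.
  apply: (@loc_integrableM _ _ _ _ _ (`|c| * B)); first exact: fU.
    by apply: measurable_funM; [exact: measurable_cst|exact: measurable_continuous].
  by move=> x; rewrite normrM ler_wpM2l.
- exact: (loc_integrable_bounded (measurable_variation_deriv sal) hM).
move=> phi tphi; have sphi : smooth phi by case: tphi.
have tphi_al := test_function_pderiv al tphi.
rewrite (integral_test _ tphi) (integral_test _ tphi_al).
have tzphi : test_function Om (z \* pderiv phi al).
  exact: (test_functionM tzOm (smooth_pderiv al sphi)).
have Ifz := loc_integrable_test fOm tzphi.
have IL := L1_leibnizM mg bg tzOm sphi (be := [::]) sal.
transitivity ((c * ((-1) ^+ size al *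
    (\int[lam]_x (leibniz g al z [::] x * phi x))%R))%:E).
  rewrite -(leibniz_weak mg bg gW tzOm sphi (be := [::]) sal).
  have -> : (\int[lam]_x (z x * g [::] x * pderiv phi al x))%R =
      (\int[lam]_x (f x * (z \* pderiv phi al) x))%R.
    have := gW (al := [::]) isT tzphi; rewrite expr0 mul1r => ->.
    by apply: eq_Rintegral => x _; rewrite /= (mulrC (z x)) mulrA.
  rewrite EFinM /Rintegral fineK; last exact: integrable_fin_num.
  rewrite -integralZl//; apply: eq_integral => x _.
  by rewrite /= -EFinM; congr EFin; ring.
rewrite mulrCA EFinM; congr (_ * _)%E.
rewrite EFinM /Rintegral fineK; last exact: integrable_fin_num.
rewrite -integralZl//; apply: eq_integral => x _.
by rewrite /= -EFinM /variation_deriv mulrA.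
Qed.

Lemma perturbed_weak_deriv al : (size al <= k)%N ->
  is_weak_deriv U (fun x => f x + c * (z x * f x)) al
    (fun x => g al x + variation_deriv al x).
Proof.
move=> sal; have [vU dvU vW] := variation_weak_deriv sal.
have [[fOm gOm gw] _ _] := gf sal.
have fU : loc_integrable U f by move=> K cK KU; apply: fOm => // x /KU /UOm.
have gU : loc_integrable U (g al) by move=> K cK KU; apply: gOm => // x /KU /UOm.
split; [exact: loc_integrableD|exact: loc_integrableD|].
move=> phi tphi; have tphi_al := test_function_pderiv al tphi.
have := vW _ tphi; have := gw _ (test_functionS UOm tphi).
have tOm := test_functionS UOm tphi.
rewrite !(integral_test _ tphi) !(integral_test _ tphi_al) (integral_test _ tOm).
rewrite (integral_test _ (test_functionS UOm tphi_al)) => E1 E2.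
under eq_integral do rewrite mulrDl EFinD.
under [in RHS]eq_integral do rewrite mulrDl EFinD.
have I1 := loc_integrable_test fU tphi_al.
have I2 := loc_integrable_test vU tphi_al.
have J1 := loc_integrable_test gU tphi.
have J2 := loc_integrable_test dvU tphi.
rewrite (integralD measurableT I1 I2) (integralD measurableT J1 J2) E1 E2.
have F1 := integrable_fin_num measurableT J1.
move: (integral _ _ _) (integral _ _ _) F1 => A B F1.
by rewrite muleDr// fin_num_adde_defr.
Qed.

(** The mollifications of the variation are test functions whose derivatives
    are the mollified weak derivatives: the reflected mollifier is a smooth
    function in the weak formulation. *)
Lemma pderiv_conv_variation eta d al x : is_mollifier d eta -> (size al <= k)%N ->
  pderiv (conv (variation_deriv [::]) eta) al x = conv (variation_deriv al) eta x.
Proof.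
move=> etaP sal; have [seta _ etad _ _] := etaP.
have I0 : L1 (variation_deriv [::]) by exact: L1_variation_deriv.
rewrite pderiv_conv//; last by exists d.
have sre : smooth (fun y => eta (x - y)) by exact: smooth_reflect.
have srea := smooth_pderiv al sre.
have ceta := smooth_continuous (smooth_pderiv al seta).
transitivity (c * ((-1) ^+ size al *
   (\int[lam]_y (z y * g [::] y * pderiv (fun y => eta (x - y)) al y))%R)).
  rewrite /conv -RintegralZl//; last first.
    have := L1_leibnizM mg bg tzOm srea (al := [::]) (be := [::]) isT.
    by [].
  rewrite -RintegralZl//; last first.
    have := L1_leibnizM mg bg tzOm srea (al := [::]) (be := [::]) isT.
    by move=> h; exact: L1Z.
  apply: eq_Rintegral => y _; rewrite (pderiv_reflect _ _ seta).
  by rewrite [X in _ = c * X]mulrCA signrMK mulrA.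
rewrite (leibniz_weak mg bg gW tzOm sre (be := [::]) sal) signrMK.
rewrite /conv -RintegralZl//; last first.
  exact: (L1_leibnizM mg bg tzOm sre (be := [::]) sal).
by apply: eq_Rintegral => y _; rewrite /variation_deriv mulrA.
Qed.

(** The cutoff leaves room for mollification, so the mollified variations are test
    functions of [U]; they converge in [W^(k,1)] because their derivatives are
    mollifications. *)
Lemma variation_approximants : exists2 phi : (V -> R)^nat,
  forall m, test_function U (phi m) &
  forall al, (size al <= k)%N ->
    Lp_norm 1%:E U (pderiv (phi m) al \- weak_deriv U (fun x => c * (z x * f x)) al)
      @[m --> \oo] --> 0%E.
Proof.
have [eta etaP] := mollifier_sequence nonnull.
have [sz cz zU] := tz.
have [r r0 hr] := compact_margin cz oU zU.
have [m0 m0r] : exists m0 : nat, m0.+1%:R^-1 < r / 2.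
  have r2 : 0 < r / 2 by rewrite divr_gt0.
  by have [m0 _ /(_ m0 (leqnn m0))] := near_infty_natSinv_lt (PosNum r2); exists m0.
pose phi m := conv (variation_deriv [::]) (eta (m + m0)%N).
exists phi.
  move=> m; have [seta _ etad _ _] := etaP (m + m0)%N.
  set d := _^-1 in etad.
  have dr : d < r / 2.
    apply: le_lt_trans m0r; rewrite lef_pV2 ?posrE// ler_nat ltnS; exact: leq_addl.
  pose S := [set y | exists2 x, closure [set x | z x != 0] x & `|x - y| < d].
  have [B [_ hB]] := compact_bounded cz.
  apply: (@test_function_within _ _ _ _ S (r / 2)); first by rewrite divr_gt0.
  - apply: smooth_conv => //; first exact: L1_variation_deriv.
    by exists d.
  - exists (B + 1 + d); split; first exact: num_real.
    move=> s Bs y [x zx xy]; have := hB (B + 1) _ x zx.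
    rewrite ltrDl ltr01 => /(_ isT) /= xB.
    by have := ler_normD (y - x) x; rewrite subrK distrC; lra.
  - move=> x; apply: contraPP => Sx /eqP; apply.
    rewrite -[RHS](_ : (\int[lam]_(y in setT) (cst 0 y))%R = 0); last first.
      by rewrite /Rintegral integral0.
    apply: eq_Rintegral => y _; rewrite /variation_deriv /=.
    have [zy|zy] := eqVneq (z y) 0; first by rewrite zy mul0r mulr0 mul0r.
    rewrite etad ?mulr0// leNgt; apply/negP => xy; apply: Sx.
    by exists y; [exact: subset_closure|rewrite distrC].
  - move=> y t [x zx xy] yt; apply: (hr x) => //.
    by have := ler_distD y x t; lra.
move=> al sal; apply/cvge0P => [m|e e0].
  by rewrite /Lp_norm Lnorm_ge0.
have IL := L1_variation_deriv sal.
have [_ /(_ e e0)[m1 _ hm1]] := approximable_L1 etaP IL.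
exists m1 => // m /= m1m; apply: le_trans (hm1 (m + m0)%N _); last first.
  by rewrite /= (leq_trans m1m)// leq_addr.
have Ic := L1_conv (etaP (m + m0)%N) IL.
have wd := weak_derivP (variation_weak_deriv sal).
have wdE := is_weak_deriv_unique nonnull oU (variation_weak_deriv sal) wd.
rewrite -(@Lp_norm1_ae _ _ _ (conv (variation_deriv al) (eta (m + m0)%N) \-
    variation_deriv al)) //; last 2 first.
- exact: L1B.
- apply: filterS wdE => x /= + Ux => /(_ Ux) <-.
  by rewrite /phi (pderiv_conv_variation _ (etaP _)).
apply: le_trans (Lp_norm1_restrict oU (L1B Ic IL)) _.
rewrite le_eqVlt; apply/orP; left; apply/eqP; apply: eq_integral => x _ /=.
by rewrite distrC.
Qed.

End CutoffVariation.

(** * The density on jets *)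

Section EnergyDensity.
Context {R : realType} {n N k : nat}.
Local Notation V := 'rV[R]_n.
Local Notation T := (lebesgue_type R n).
Local Notation lam := (@lebesgue R n).
Local Notation J := 'rV[R]_(jet_dim n N k).
Implicit Types (H : V -> J -> R) (Om U S : set V) (X Y : J).

Lemma enormZ m (a : R) (x : 'rV[R]_m) : enorm (a *: x) = `|a| * enorm x.
Proof.
rewrite /enorm -sqrtr_sqr -sqrtrM ?sqr_ge0//; congr Num.sqrt.
by rewrite mulr_sumr; apply: eq_bigr => i _; rewrite mxE exprMn.
Qed.

Lemma enorm_ge0 m (x : 'rV[R]_m) : 0 <= enorm x.
Proof. exact: sqrtr_ge0. Qed.

Lemma enorm0 m : enorm (0 : 'rV[R]_m) = 0.
Proof.
by rewrite /enorm big1 ?sqrtr0// => i _; rewrite mxE expr0n.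
Qed.

Lemma enorm_gt0 m (x : 'rV[R]_m) : x != 0 -> 0 < enorm x.
Proof.
move=> x0; rewrite sqrtr_gt0 lt0r sumr_ge0 ?andbT; last first.
  by move=> i _; exact: sqr_ge0.
apply: contra x0 => /eqP s0; apply/eqP/rowP => i; rewrite mxE; apply/eqP.
rewrite -sqrf_eq0; apply/eqP; apply: (psumr_eq0P _ s0) => // j _.
exact: sqr_ge0.
Qed.

Lemma enorm_le m (x : 'rV[R]_m) (A : 'I_m -> R) : (forall i, `|x 0 i| <= A i) ->
  enorm x <= Num.sqrt (\sum_i A i ^+ 2).
Proof.
move=> xA; apply: ler_wsqrtr; apply: ler_sum => i _.
by rewrite -real_normK ?num_real// lerXn2r ?nnegrE ?normr_ge0//
  (le_trans _ (xA i)).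
Qed.

Lemma continuous_enorm m : continuous (@enorm R m).
Proof.
move=> x; apply: (@continuous_comp _ _ _ (fun x : 'rV[R]_m => \sum_i x 0 i ^+ 2)
  (@Num.sqrt R)); last exact: sqrt_continuous.
suff h (r : seq 'I_m) : continuous (fun x : 'rV[R]_m => \sum_(i <- r) x 0 i ^+ 2).
  exact: h.
elim: r => [|i r IH].
  rewrite (_ : (fun x => _) = cst 0); first exact: cst_continuous.
  by apply/funext => y; rewrite big_nil.
rewrite (_ : (fun x => _) =
  (fun y : 'rV[R]_m => y 0 i * y 0 i) \+ (fun y => \sum_(i <- r) y 0 i ^+ 2)).
  move=> y; apply: continuousD; last exact: IH.
  by apply: (@continuousM _ _ (fun y : 'rV[R]_m => y 0 i) (fun y => y 0 i));
    exact: coord_continuous.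
by apply/funext => y; rewrite big_cons.
Qed.

Lemma eball_nbhs (x : V) (e : R) : 0 < e -> nbhs x (eball x e).
Proof.
move=> e0; have /(_ (x - x)) := @continuous_enorm n.
rewrite subrr => /(_ [set t | t < e]) h.
have /h : nbhs (enorm (0 : V)) [set t | t < e] by rewrite enorm0; exact: lt_nbhsl.
move=> /nbhs_ballP[d /= d0 hd]; apply/nbhs_ballP; exists d => // y.
rewrite -ball_normE /= distrC => xy; apply: hd; rewrite -ball_normE /=.
by rewrite sub0r normrN.
Qed.

(** The gap of the radial monotonicity is bounded below on a spherical shell, by
    compactness. The exceptional null set depends on the vector, so the bound is
    first obtained for rational vectors and then extended by continuity. *)
Lemma radial_gap Om H (t r rho : R) : caratheodory Om H ->
  radially_monotone Om H -> 0 < t < 1 -> 0 < r ->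
  exists2 kappa, 0 < kappa &
  almost_everywhere lam [set x | Om x -> forall X, r <= enorm X <= rho ->
    H x (t *: X) <= H x X - kappa].
Proof.
move=> [_ Hcont] [c [ccont _ _ _ cpos] Hrad] t01 r0.
pose a := r / 2; pose b := `|rho| + r; pose A := [set t] `*` `[a, b]%classic.
have AD : A `<=` `[0, 1] `*` `[0, +oo[.
  move=> [t' s] [/= ->]; rewrite in_itv/= => /andP[as_ _].
  have /andP[t0 t1] := t01; split; rewrite /= in_itv/=; first by rewrite !ltW.
  by rewrite andbT; apply: le_trans as_; rewrite /a divr_ge0// ltW.
have cA : compact A by apply: compact_setX; [exact: compact_set1|exact: segment_compact].
have A0 : A !=set0.
  exists (t, r); split=> //=; rewrite in_itv/= /a /b; apply/andP; split; first lra.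
  by rewrite lerDr.
have [[t' s0] At cmin] := compact_EVT_min A0 cA (continuous_subspaceW AD ccont).
have [t't] : t' = t /\ a <= s0 by move: At; rewrite inE => -[/= -> /[!in_itv]/= /andP[]].
rewrite {}t't in At cmin * => as0.
have a0 : 0 < a by rewrite divr_gt0.
exists (c (t, s0)); first by apply: cpos => //; exact: lt_le_trans as0.
have Hq : almost_everywhere lam [set x | forall i : nat, Om x ->
    if @unpickle 'rV[rat]_(jet_dim n N k) i is Some q
    then H x (t *: map_mx ratr q) <= H x (map_mx ratr q) -
           c (t, enorm (map_mx ratr q : J)) else true].
  apply: ae_foralln => i; case: unpickle => [q|]; last exact: aeW.
  by apply: Hrad; have /andP[t0 t1] := t01; rewrite !ltW.
apply: filterS2 Hq Hcont => x /= Hq Hc Omx X /andP[rX Xrho].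
rewrite leNgt; apply/negP => lt_H.
have nearX : nbhs X [set Y : J | [/\ H x Y - c (t, s0) < H x (t *: Y),
    a < enorm Y & enorm Y < b]].
  have cX : {for X, continuous (H x)} by exact: Hc.
  have cE : {for X, continuous (@enorm R (jet_dim n N k))} by exact: continuous_enorm.
  have cZ : {for X, continuous (fun Y : J => H x (t *: Y))}.
    apply: (@continuous_comp _ _ _ (fun Y : J => t *: Y) (H x)).
      exact: scaler_continuous.
    exact: Hc.
  have cD : {for X, continuous (fun Y : J => H x (t *: Y) - H x Y)}.
    exact: (@continuousB _ _ _ (fun Y : J => H x (t *: Y)) (H x) X cZ cX).
  have h1 : nbhs X [set Y : J | - c (t, s0) < H x (t *: Y) - H x Y].
    have h0 : - c (t, s0) < H x (t *: X) - H x X by lra.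
    exact: cD (lt_nbhsr h0).
  have h2 : nbhs X [set Y : J | a < enorm Y].
    have h0 : a < enorm X by rewrite /a; lra.
    exact: cE (lt_nbhsr h0).
  have h3 : nbhs X [set Y : J | enorm Y < b].
    have h0 : enorm X < b.
      by apply: (le_lt_trans Xrho); apply: (le_lt_trans (ler_norm _)); rewrite /b ltrDl.
    exact: cE (lt_nbhsl h0).
  apply: (@filterS3 _ (nbhs X) _ _ _ _ _ _ h1 h2 h3) => Y /= h1' h2' h3'.
  by split=> //; lra.
move/nbhs_ballP : nearX => [e /= e0 he].
have [q /he /= [q1 q2 q3]] := rational_dense X e0.
have := Hq (pickle q) Omx; rewrite pickleK => q4.
have : c (t, s0) <= c (t, enorm (map_mx ratr q : J)).
  by apply: cmin; rewrite inE; split=> //=; rewrite in_itv/= !ltW.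
lra.
Qed.

Lemma modulus_near Om H (rho e : R) : uniform_modulus Om H -> 0 < rho -> 0 < e ->
  exists2 d, 0 < d & almost_everywhere lam [set x | Om x -> forall X Y,
    enorm X <= rho -> enorm Y <= rho -> enorm (X - Y) < d ->
    `|H x X - H x Y| <= e].
Proof.
move=> Hmod rho0 e0; have [w [_ _ w0] Hw] := Hmod rho rho0.
have [d /= d0 hd] : \forall s \near 0^'+, w s < e by exact: (cvgr_lt 0).
exists d => //; apply: filterS Hw => x /= Hw Omx X Y Xr Yr XY.
have [->|XneY] := eqVneq X Y; first by rewrite subrr normr0 ltW.
apply: (le_trans (Hw Omx X Y Xr Yr XneY)); apply: ltW.
have XY0 : 0 < enorm (X - Y) by apply: enorm_gt0; rewrite subr_eq0.
by apply: hd => //=; rewrite sub0r normrN gtr0_norm.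
Qed.

(** Compare with the value at 0. *)
Lemma density_bounded Om H (rho : R) : uniform_modulus Om H -> 0 < rho ->
  almost_everywhere lam [set x | Om x -> H x 0 = 0] ->
  exists C, almost_everywhere lam [set x | Om x -> forall X, enorm X <= rho ->
    H x X <= C].
Proof.
move=> Hmod rho0 H0; have [w [wmono _ _] Hw] := Hmod rho rho0.
exists (Num.max 0 (w rho)); apply: filterS2 H0 Hw => x /= H0 Hw Omx X Xr.
have [->|X0] := eqVneq X 0; first by rewrite H0// le_max lexx.
have := Hw Omx X 0 Xr; rewrite enorm0 (ltW rho0) => /(_ isT X0).
rewrite H0// !subr0 => h; rewrite le_max; apply/orP; right.
apply: (le_trans (ler_norm _)); apply: (le_trans h).
by apply: wmono => //; rewrite in_itv/= andbT ?enorm_gt0.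
Qed.

Lemma ess_sup_on_le S (h : V -> \bar R) (y : \bar R) :
  (ess_sup_on S h <= y)%E <-> almost_everywhere lam [set x | S x -> (h x <= y)%E].
Proof.
split=> [/ess_supP|] hy.
  by apply: filterS hy => x /= + Sx; rewrite /patch mem_set.
apply/ess_supP; apply: filterS hy => x /= hy; rewrite /patch.
by case: ifPn => [|_]; [rewrite inE|rewrite leNye].
Qed.

Lemma ess_sup_onS S1 S2 (h : V -> \bar R) : S1 `<=` S2 ->
  (ess_sup_on S1 h <= ess_sup_on S2 h)%E.
Proof.
move=> S12; apply/ess_sup_on_le.
have /ess_sup_on_le : (ess_sup_on S2 h <= ess_sup_on S2 h)%E by [].
by apply: filterS => x /= + /S12.
Qed.

(** The essential supremum decreases with the radius. *)
Lemma ess_limsupE U (h : V -> \bar R) (x : V) : ess_limsup U h x =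
  ereal_inf [set ess_sup_on (eball x e `&` U) h | e in [set e : R | 0 < e]].
Proof.
rewrite /ess_limsup; apply/cvg_lim => //.
rewrite (_ : [set e : R | 0 < e] = [set` Interval (BRight 0) (+oo%O : itv_bound R)]).
  apply: nondecreasing_at_right_cvge => // d e _ _ de.
  by apply: ess_sup_onS => y [/= yd Uy]; split=> //; exact: lt_le_trans de.
by apply/seteqP; split=> e /=; rewrite in_itv/= andbT.
Qed.

End EnergyDensity.

(** * Jets of the perturbed map *)

Section JetVariation.
Context {R : realType} {n N k : nat}.
Local Notation V := 'rV[R]_n.
Local Notation T := (lebesgue_type R n).
Local Notation lam := (@lebesgue R n).
Local Notation J := 'rV[R]_(jet_dim n N k).
Implicit Types (Om U S : set V) (u v : V -> 'rV[R]_N) (al : seq 'I_n).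
Implicit Types (g h : 'I_N -> seq 'I_n -> V -> R).

Hypothesis nonnull : ~ lam.-negligible [set: V].

(** A jet read off a family of functions defined everywhere, to be used in place
    of the weak derivatives, which are determined up to null sets. *)
Definition family_jet h (x : V) : J :=
  \row_(c < jet_dim n N k) let: (a, al) := tagged (enum_val c) in h a al x.

Definition bounded_family h := forall a al, (size al <= k)%N ->
  measurable_fun (setT : set T) (h a al) /\ exists M, forall x, `|h a al x| <= M.

Lemma family_jetE c : exists a al, (size al <= k)%N /\
  forall h x, family_jet h x 0 c = h a al x.
Proof.
case E : (tagged (enum_val c)) => [a al]; exists a, al; split.
  by rewrite size_tuple -ltnS.
by move=> h x; rewrite mxE E.
Qed.

(** One radius for all the perturbed jets, so that one modulus of continuity
    serves for all of them. *)
Lemma family_jet_bounded h1 h2 : bounded_family h1 -> bounded_family h2 ->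
  exists2 rho, 0 < rho & forall x (c : R), `|c| <= 1 ->
    enorm (family_jet h1 x + c *: family_jet h2 x) <= rho /\
    enorm (family_jet h2 x) <= rho.
Proof.
move=> b1 b2.
have bnd h : bounded_family h -> {M : 'I_(jet_dim n N k) -> R &
    forall i, 0 <= M i /\ forall x, `|family_jet h x 0 i| <= M i}.
  move=> bh; apply: (@choice _ _ (fun i M => 0 <= M /\
    forall x, `|family_jet h x 0 i| <= M)) => i.
  have [a [al [sal E]]] := family_jetE i.
  have [_ [M hM]] := bh a al sal; exists M; split.
    exact: le_trans (hM 0).
  by move=> x; rewrite E.
have [M1 h1M] := bnd _ b1; have [M2 h2M] := bnd _ b2.
pose rho := Num.sqrt (\sum_i (M1 i + M2 i) ^+ 2) + 1.
have rho0 : 0 < rho by rewrite ltr_pwDr// sqrtr_ge0.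
exists rho => // x c c1; split; apply: (@le_trans _ _ (rho - 1)); rewrite ?gerBl//;
  rewrite /rho addrK; apply: enorm_le => i.
  rewrite !mxE (le_trans (ler_normD _ _))// lerD//.
    by have := (h1M i).2 x; rewrite mxE.
  rewrite normrM; have := (h2M i).2 x; rewrite mxE => h.
  by apply: le_trans h; rewrite ler_piMl.
by apply: le_trans ((h2M i).2 x) _; rewrite lerDr (h1M i).1.
Qed.

Lemma jet_ae S v h : open S ->
  (forall a al, (size al <= k)%N ->
     is_weak_deriv S (fun x => v x 0 a) al (h a al)) ->
  almost_everywhere lam [set x | S x -> @jet R n N k S v x = family_jet h x].
Proof.
move=> oS hw.
have ae_c (c : 'I_(jet_dim n N k)) : almost_everywhere lam
    [set x | S x -> @jet R n N k S v x 0 c = family_jet h x 0 c].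
  rewrite (_ : [set x | _] = [set x | S x -> (let: (a, al) := tagged (enum_val c) in
    weak_deriv S (fun y => v y 0 a) al x) = (let: (a, al) := tagged (enum_val c) in
    h a al x)]); last by apply/seteqP; split=> x /=; rewrite !mxE.
  case: (tagged (enum_val c)) => a al.
  have sal : (size al <= k)%N by rewrite size_tuple -ltnS.
  exact: (is_weak_deriv_unique nonnull oS (weak_derivP (hw a al sal)) (hw a al sal)).
have := @filter_forall _ _ (fun c => [set x | S x ->
  @jet R n N k S v x 0 c = family_jet h x 0 c]) (almost_everywhere lam) _ ae_c.
move=> /(_ _) hall; apply: (@filterS V (almost_everywhere lam) _ _ _ _ hall) => x hx Sx.
by apply/rowP => c; exact: hx.
Qed.

Lemma sobolev_family Om u : open Om -> sobolev k +oo%E Om u ->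
  exists g, bounded_family g /\ forall a al, (size al <= k)%N ->
    is_weak_deriv Om (fun x => u x 0 a) al (g a al).
Proof.
move=> oOm su.
have [G GP] : {G : 'I_N * seq 'I_n -> V -> R & forall p, (size p.2 <= k)%N ->
    [/\ is_weak_deriv Om (fun x => u x 0 p.1) p.2 (G p),
        measurable_fun (setT : set T) (G p) & exists M, forall x, `|G p x| <= M]}.
  apply: (@choice _ _ (fun (p : 'I_N * seq 'I_n) (h : V -> R) => (size p.2 <= k)%N ->
    [/\ is_weak_deriv Om (fun x => u x 0 p.1) p.2 h,
        measurable_fun (setT : set T) h & exists M, forall x, `|h x| <= M])).
  move=> [a al] /=; have [sal|_] := boolP (size al <= k)%N; last by exists (cst 0).
  have [g gw gLp] := su a al sal.
  by have [h hP] := bounded_representative nonnull oOm gw gLp; exists h.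
exists (fun a al => G (a, al)); split=> a al sal; have [] := GP (a, al) sal => //.
Qed.

Section Variation.
Variables (Om U : set V) (u : V -> 'rV[R]_N) (z : V -> R) (c : R).
Variable g : 'I_N -> seq 'I_n -> V -> R.
Hypotheses (oU : open U) (bU : bounded_set U) (UOm : U `<=` Om).
Hypothesis tz : test_function U z.
Hypothesis bg : bounded_family g.
Hypothesis gw : forall a al, (size al <= k)%N ->
  is_weak_deriv Om (fun x => u x 0 a) al (g a al).

Let gP a al : (size al <= k)%N -> [/\ is_weak_deriv Om (fun x => u x 0 a) al (g a al),
  measurable_fun (setT : set T) (g a al) & exists M, forall x, `|g a al x| <= M].
Proof. by move=> sal; have [? ?] := bg a sal; split=> //; exact: gw. Qed.

Definition variation x : 'rV[R]_N := c *: (z x *: u x).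

Let variationE a : (fun x => variation x 0 a) = (fun x => c * (z x * u x 0 a)).
Proof. by apply/funext => x; rewrite !mxE. Qed.

Lemma sobolev_infty0_variation : sobolev_infty0 k U variation.
Proof.
have wd a al : (size al <= k)%N -> is_weak_deriv U (fun x => variation x 0 a) al
    (variation_deriv (g a) z c al).
  by move=> sal; rewrite variationE; exact: (variation_weak_deriv c UOm tz (gP a)).
split; last split.
- move=> a al sal; exists (variation_deriv (g a) z c al); first exact: wd.
  have [M hM] := variation_deriv_bounded c UOm tz (gP a) sal.
  apply: (bounded_Lp_oo nonnull U _ hM).
  exact: (measurable_variation_deriv c UOm tz (gP a)).
- move=> a al sal; exists (variation_deriv (g a) z c al); first exact: wd.
  have IL := L1_variation_deriv c UOm tz (gP a) sal.
  split; first by apply: measurable_funTS; exact: measurable_L1.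
  apply: (le_lt_trans (Lp_norm1_restrict oU IL)).
  by have /integrableP[] := IL.
- move=> a; rewrite variationE.
  exact: (variation_approximants nonnull c oU UOm tz (gP a)).
Qed.

(** The jet of [z * u], up to null sets. *)
Definition leibniz_family a al := leibniz (g a) al z [::].

Lemma bounded_leibniz_family : bounded_family leibniz_family.
Proof.
move=> a al sal; have tzOm := test_functionS UOm tz; split.
  apply: (leibniz_measurable (Om := Om) (k := k)) => // be sbe.
  by have [] := bg a sbe.
apply: (leibniz_bounded (Om := Om) (k := k)) => // be sbe.
by have [] := bg a sbe.
Qed.

(** The jet of the perturbed map, taken on [U], and that of [u], taken on the
    larger set, are comparable because weak derivatives are unique. *)
Lemma jet_perturbed_ae : almost_everywhere lam [set x | U x ->
  @jet R n N k U (u \+ variation) x =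
  family_jet g x + c *: family_jet leibniz_family x].
Proof.
pose h a al x := g a al x + variation_deriv (g a) z c al x.
have := @jet_ae U (u \+ variation) h oU.
have hw a al : (size al <= k)%N ->
    is_weak_deriv U (fun x => (u \+ variation) x 0 a) al (h a al).
  move=> sal; rewrite (_ : (fun x => _) =
      (fun x => u x 0 a + c * (z x * u x 0 a))); last first.
    by apply/funext => x; rewrite !mxE.
  exact: (perturbed_weak_deriv c UOm tz (gP a)).
move=> /(_ hw); apply: filterS => x /= + Ux => /(_ Ux) ->.
by apply/rowP => i; rewrite !mxE; case: (tagged (enum_val i)).
Qed.

End Variation.
End JetVariation.

(** * The energy maximum principle *)

Section Frontier.
Context {R : realType} {n : nat}.
Local Notation V := 'rV[R]_n.
Implicit Types (U : set V) (x : V).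

(** If the frontier is empty, the part of the set on a line through one of its
    points is open and closed in the line, hence is the line, which is unbounded. *)
Lemma frontier_nonempty U : (0 < n)%N -> open U -> bounded_set U -> U !=set0 ->
  frontier U !=set0.
Proof.
move=> n0 oU [M [_ UM]] [x Ux]; apply: contrapT => /set0P/negP/negPn/eqP fU.
have clU : closed U.
  move=> y cy; apply: contrapT => Uy; have : frontier U y.
    by split=> // /interior_subset.
  by rewrite fU.
pose i : 'I_n := Ordinal n0; pose l (t : R) : V := t *: 'e_i + x.
have cl : continuous l.
  move=> t; apply: (@continuousD _ _ _ (fun t : R => t *: ('e_i : V)) (cst x)).
    by apply: scalel_continuous.
  exact: cst_continuous.
have AT : [set t | U (l t)] = setT.
  have /connected_intervalP cT : is_interval [set: R] by [].
  apply: cT.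
  - by exists 0; rewrite /= /l scale0r add0r.
  - exists [set t | U (l t)]; last by rewrite setTI.
    by apply: (@open_comp _ _ l U) => // t _; exact: cl.
  - exists [set t | U (l t)]; last by rewrite setTI.
    by apply: (@closed_comp _ _ l U) => // t _; exact: cl.
pose t := `|M| + 1 + `|x| + 1.
have : [set t | U (l t)] t by rewrite AT.
move=> /= /(UM (`|M| + 1) _ (l t)); rewrite (le_lt_trans (ler_norm M)) ?ltrDl//.
move=> /(_ isT) lt; have := rV_coord_le (l t) i.
rewrite /l !mxE !eqxx mulr1 => h; have := le_trans h lt.
have := rV_coord_le x i; rewrite /t ler_norml => /andP[h1 h2].
by rewrite ler_norml => /andP[_]; lra.
Qed.

End Frontier.

Theorem theorem1p2 (R : realType) (n N k : nat)
    (n_gt0 : (0 < n)%N) (N_gt0 : (0 < N)%N) (k_gt0 : (0 < k)%N)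
    (Omega : set 'rV[R]_n)
    (Omega_open : open Omega) (Omega_bounded : bounded_set Omega)
    (H : 'rV[R]_n -> 'rV[R]_(jet_dim n N k) -> R)
    (H_ge0 : forall x X, Omega x -> 0 <= H x X)
    (H_caratheodory : caratheodory Omega H)
    (H_0 : \forall x \ae @lebesgue R n, Omega x -> H x 0 = 0)
    (H_radial : radially_monotone Omega H)
    (H_modulus : uniform_modulus Omega H)
    (u : 'rV[R]_n -> 'rV[R]_N)
    (u_sobolev : sobolev k +oo%E Omega u)
    (u_min : absolute_minimiser H Omega u) :
  forall U : set 'rV[R]_n, open U -> U `<=` Omega ->
    ess_sup_on U (density H Omega u) =
    ereal_sup [set ess_limsup U (density H Omega u) x | x in frontier U].
Proof.
move=> U oU UOm; set h := density H Omega u.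
pose lam := @lebesgue R n.
apply/eqP; rewrite eq_le; apply/andP; split; last first.
  apply: ge_ereal_sup => _ [x _ <-]; rewrite ess_limsupE.
  apply: (@le_trans _ _ (ess_sup_on (eball x 1 `&` U) h)).
    by apply: ereal_inf_lbound; exists 1 => //=.
  by apply: ess_sup_onS; exact: subIsetr.
rewrite leNgt; apply/negP; set S := ereal_sup _; set E := ess_sup_on U h => SE.
have bU : bounded_set U.
  by have [M [Mr OM]] := Omega_bounded; exists M; split=> // y My x /UOm; exact: OM.
have UN : ~ lam.-negligible U.
  move=> U0; move: SE; rewrite (_ : E = -oo%E) ?ltNge ?leNye//.
  apply/eqP; rewrite -leeNy_eq; apply/ess_sup_on_le.
  by apply: negligibleS U0 => x /= /not_implyP[].
have nonnull : ~ lam.-negligible [set: 'rV[R]_n].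
  by move=> T0; apply: UN; apply: negligibleS T0.
have posN W : open W -> W !=set0 -> ~ lam.-negligible W.
  by move=> oW W0 /(negligible_open [set: 'rV[R]_n] oW W0).
have [xf fx] : frontier U !=set0.
  apply: frontier_nonempty => //; apply: contrapT => /set0P/negP/negPn/eqP U0.
  by apply: UN; rewrite U0; exact: negligible_set0.
(* The values of H are nonnegative, hence so is the boundary supremum. *)
have S0 : (0 <= S)%E.
  apply: (@le_trans _ _ (ess_limsup U h xf)); last first.
    by apply: ereal_sup_ubound; exists xf.
  rewrite ess_limsupE; apply: le_ereal_inf_tmp => _ [e /= e0 <-].
  rewrite leNgt; apply/negP => lt0.
  have /ess_sup_on_le : (ess_sup_on (eball xf e `&` U) h <=
    ess_sup_on (eball xf e `&` U) h)%E by [].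
  have [W [oW xW We]] : exists W, [/\ open W, W xf & W `<=` eball xf e].
    by have := eball_nbhs xf e0; rewrite nbhsE => -[W [oW Wx] We]; exists W.
  move=> ae0; apply: (posN (W `&` U)); first exact: openI.
    have [cx _] := fx; have [y [Uy Wy]] := cx W (open_nbhs_nbhs (conj oW xW)).
    by exists y.
  apply: negligibleS ae0 => y /= [Wy Uy] hy.
  have := hy (conj (We y Wy) Uy) => /le_lt_trans /(_ lt0).
  by rewrite lte_fin ltNge H_ge0//; exact: UOm.
have [g [bg gw]] := sobolev_family nonnull Omega_open u_sobolev.
have jetE := jet_ae nonnull Omega_open gw.
(* The jet is bounded, hence so is the energy. *)
have Efin : E \is a fin_num.
  rewrite fin_real// (lt_le_trans (ltNyr 0) (le_trans S0 (ltW SE)))/=.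
  have [rho rho0 grho] := family_jet_bounded bg bg.
  have [C HC] := density_bounded H_modulus rho0 H_0.
  apply: (@le_lt_trans _ _ C%:E); last exact: ltry.
  apply/ess_sup_on_le; apply: filterS2 HC jetE => x /= HC jx Ux.
  rewrite /h /density lee_fin jx; last exact: UOm.
  apply: HC; first exact: UOm.
  by have [] := grho x 0; rewrite ?normr0.
have Sfin : S \is a fin_num.
  by rewrite fin_real// (lt_le_trans (ltNyr 0) S0) (lt_trans SE)// ltey_eq Efin.
pose s := (fine S + fine E) / 2.
have SEr : fine S < fine E by rewrite fine_lt.
have S0r : 0 <= fine S by rewrite fine_ge0.
have s0 : 0 < s by rewrite /s; lra.
have Ss : (S < s%:E)%E by rewrite -(fineK Sfin) lte_fin /s; lra.
have sE : s < fine E by rewrite /s; lra.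
(* A point belongs to O when the density is at most s near it; this local
   condition is open, and holds on the frontier because S < s. *)
pose O := [set y : 'rV[R]_n | exists2 d : R, 0 < d &
  almost_everywhere lam [set t | `|y - t| < d -> U t -> (h t <= s%:E)%E]].
have oO : open O.
  rewrite openE => y [d d0 hd]; apply/nbhs_ballP.
  exists (d / 2); first by rewrite /= divr_gt0.
  move=> y'; rewrite -ball_normE /= => yy'; exists (d / 2); first by rewrite divr_gt0.
  apply: filterS hd => t /= hd y't; apply: hd.
  by have := ler_distD y' y t; lra.
have Oh : almost_everywhere lam [set t | O t -> U t -> (h t <= s%:E)%E].
  by apply: ae_local => y.
have fO : frontier U `<=` O.
  move=> y fy; have : (ess_limsup U h y < s%:E)%E.
    by apply: le_lt_trans Ss; apply: ereal_sup_ubound; exists y.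
  rewrite ess_limsupE => /ereal_inf_lt[_ [e /= e0 <-] /ltW /ess_sup_on_le he].
  have /nbhs_ballP[d /= d0 hd] := eball_nbhs y e0; exists d => //.
  apply: filterS he => t /= he yt Ut; apply: he; split=> //.
  by apply: hd; rewrite -ball_normE.
pose K := closure U `\` O.
have cK : compact K.
  apply: bounded_closed_compact.
    have [M [Mr UM]] := bU; exists (M + 1); split; first exact: num_real.
    move=> r Mr' x [cx _]; have e0 : 0 < (r - M) / 2 by rewrite divr_gt0//; lra.
    have [y Uy xy] := closure_dist cx e0.
    have := UM ((r + M) / 2) _ y Uy; move=> /(_ _)/= yM.
    have /yM {}yM : M < (r + M) / 2 by lra.
    by have := ler_normD (x - y) y; rewrite subrK; lra.
  apply: closedI; first exact: closed_closure.
  exact: open_closedC.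
have KU : K `<=` U.
  move=> x [cx Ox]; apply: interior_subset; apply: contrapT => ix; apply: Ox.
  by apply: fO.
have [z [tz [dz dz0 z1]]] := cutoff_exists nonnull cK oU KU.
pose L := leibniz_family z g.
have bL : bounded_family (k := k) L by exact: (bounded_leibniz_family UOm tz bg).
have [rho rho0 hrho] := family_jet_bounded bg bL.
have gap0 : 0 < (fine E - s) / 2 by rewrite divr_gt0// subr_gt0.
have [d1 d10 mod1] := modulus_near H_modulus rho0 gap0.
have [r r0 mod2] := modulus_near H_modulus rho0 s0.
(* The first bound keeps 1 - eps in ]0, 1[, the second keeps the perturbation of
   the jet in the collar within the reach d1 of the modulus of continuity. *)
pose eps := Num.min (1 / 2) (d1 / (2 * rho)).
have eps0 : 0 < eps by rewrite lt_min divr_gt0//= divr_gt0// mulr_gt0.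
have eps1 : eps <= 1 / 2 by rewrite ge_min lexx.
have eps_rho : eps * rho < d1.
  apply: (@le_lt_trans _ _ (d1 / (2 * rho) * rho)).
    by rewrite ler_wpM2r ?(ltW rho0)// ge_min lexx orbT.
  by rewrite invfM mulrA divfK ?gt_eqF//; lra.
have t01 : 0 < 1 - eps < 1 by apply/andP; split; lra.
have [kappa kappa0 rad] := @radial_gap R n N k Omega H (1 - eps) r rho
  H_caratheodory H_radial t01 r0.
have := u_min U _ oU UOm (sobolev_infty0_variation nonnull (- eps) oU UOm tz bg gw).
rewrite -/lam leNgt => /negP; apply; rewrite -/h -/E.
apply: (@le_lt_trans _ _ (Num.max (s + (fine E - s) / 2) (fine E - kappa))%:E);
  last first.
  by rewrite -[X in (_ < X)%E](fineK Efin) lte_fin gt_max; apply/andP; split; lra.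
apply/ess_sup_on_le.
have jetP := jet_perturbed_ae nonnull (- eps) oU UOm tz bg gw.
have hE : almost_everywhere lam [set x | U x -> (h x <= E)%E].
  exact/ess_sup_on_le.
apply: filterS2 (filterI jetP (filterI jetE mod1))
  (filterI (filterI mod2 rad) (filterI (filterI H_0 hE) Oh)).
move=> x /= [jP [jE m1]] [[m2 rd] [[H0 hEx] Ohx]] Ux.
have Omx := UOm x Ux; move: hEx Ohx => /(_ Ux).
rewrite /h /density (jE Omx) -[X in (_ <= X)%E -> _](fineK Efin) !lee_fin => hEx Ohx.
rewrite jP// le_max.
set X := family_jet g x in hEx Ohx *; set Y := family_jet _ x.
have eps_le1 : `|- eps| <= 1 by rewrite normrN gtr0_norm//; lra.
have [XY_rho Y_rho] := hrho x (- eps) eps_le1.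
have [X_rho _] : enorm X <= rho /\ enorm Y <= rho.
  have [] := hrho x 0; first by rewrite normr0.
  by rewrite scale0r addr0.
have [Ox|Ox] := pselect (O x).
  (* In the collar the perturbation of the jet is small. *)
  apply/orP; left; have {}Ohx := Ohx Ox Ux.
  have := m1 Omx (X + - eps *: Y) X XY_rho X_rho.
  rewrite addrAC subrr add0r enormZ normrN gtr0_norm//.
  move=> /(_ _) h1; have /h1 {}h1 : eps * enorm Y < d1.
    by apply: le_lt_trans eps_rho; rewrite ler_wpM2l// ltW.
  by have := le_trans (ler_norm _) h1; lra.
(* On the core the jet is scaled by 1 - eps. *)
have Kx : K x by split=> //; exact: subset_closure.
have -> : Y = X.
  have zx : \forall t \near x, z t = 1 by apply: (z1 x) => //; rewrite subrr normr0.
  apply/rowP => i; rewrite !mxE; case: (tagged (enum_val i)) => a al.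
  rewrite /leibniz_family leibniz_in// => ga.
  by have := nbhs_singleton (pderiv_near ga zx) => ->; case: ga.
have XE : X + - eps *: X = (1 - eps) *: X by rewrite scalerBl scale1r scaleNr.
rewrite XE; have [rX|Xr] := leP r (enorm X).
  apply/orP; right; have := rd Omx X; rewrite rX X_rho => /(_ isT).
  by move=> h1; apply: (le_trans h1); lra.
apply/orP; left.
have tX : enorm ((1 - eps) *: X) <= enorm X.
  rewrite enormZ gtr0_norm; last by lra.
  by rewrite ler_piMl ?enorm_ge0//; lra.
have := m2 Omx ((1 - eps) *: X) 0 (le_trans tX X_rho).
rewrite enorm0 subr0 (ltW rho0) => /(_ isT (le_lt_trans tX Xr)).
by rewrite H0// subr0 => /(le_trans (ler_norm _)); lra.
Qed.
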